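(* Let $\alpha\ge 3$, $\rho>0$, $t_0>0$, and let $\beta:[t_0,+\infty)\to(0,+\infty)$ be non-decreasing and continuously differentiable with $$\sup_{t\ge t_0}\frac{t\dot\beta(t)}{\beta(t)}\le \alpha-3 .$$ Let $(x,\lambda):[t_0,+\infty)\to\mathcal H\times\mathcal G$ be a solution of the differential system $$\left\{\begin{aligned} &\ddot x(t)+\frac{\alpha}{t}\dot x(t)+\beta(t)\,\partial_x\mathcal L_\rho\Big(x(t),\lambda(t)+\frac{t}{\alpha-1}\dot\lambda(t)\Big)\ni 0,\\ &\ddot\lambda(t)+\frac{\alpha}{t}\dot\lambda(t)-\beta(t)\,\nabla_\lambda\mathcal L_\rho\Big(x(t)+\frac{t}{\alpha-1}\dot x(t),\lambda(t)\Big)=0. \end{aligned}\right.$$ Then, for any $(x^*,\lambda^* )\in\mathcal S$, as $t\to+\infty$, $$\mathcal L_\rho(x(t),\lambda^* )-\mathcal L_\rho(x^*,\lambda^* )=\mathcal O\Big(\frac{1}{t^2\beta(t)}\Big),$$ $$\|Ax(t)-b\|=\mathcal O\Big(\frac{1}{t\sqrt{\beta(t)}}\Big),\qquad |(f+g)(x(t))-(f+g)(x^* )|=\mathcal O\Big(\frac{1}{t\sqrt{\beta(t)}}\Big),$$ and moreover $$\int_{t_0}^{+\infty}t\beta(t)\,\|Ax(t)-b\|^2\,dt<+\infty,$$ $$\int_{t_0}^{+\infty}\big((\alpha-3)t\beta(t)-t^2\dot\beta(t)\big)\big(\mathcal L_\rho(x(t),\lambda^* )-\mathcal L_\rho(x^*,\lambda^*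 )\big)\,dt<+\infty .$$
   Context: $\mathcal H$ and $\mathcal G$ are real Hilbert spaces; $f:\mathcal H\to\mathbb R$ is convex and differentiable with Lipschitz continuous gradient; $g:\mathcal H\to\mathbb R$ is proper, convex and lower semicontinuous; $A:\mathcal H\to\mathcal G$ is a continuous linear operator with adjoint $A^*$; $b\in\mathcal G$. The underlying problem is to minimize $f(x)+g(x)$ over $x\in\mathcal H$ subject to $Ax=b$. The augmented Lagrangian is $\mathcal L_\rho(x,\lambda)=f(x)+g(x)+\langle\lambda,Ax-b\rangle+\frac{\rho}{2}\|Ax-b\|^2$. Its partial (sub)differentials are $\partial_x\mathcal L_\rho(x,\lambda)=\nabla f(x)+\partial g(x)+A^*\lambda+\rho A^*(Ax-b)$, where $\partial g$ is the convex subdifferential, and $\nabla_\lambda\mathcal L_\rho(x,\lambda)=Ax-b$. $\mathcal S$ denotes the set of saddle points of $\mathcal L_\rho$, i.e. pairs $(x^*,\lambda^* )\in\mathcal H\times\mathcal G$ with $\mathcal L_\rho(x^*,\lambda)\le\mathcal L_\rho(x^*,\lambda^* )\le\mathcal L_\rho(x,\lambda^* )$ for all $(x,\lambda)\in\mathcal H\times\mathcal G$; equivalently $0\in\nabla f(x^* )+\partial g(x^* )+A^*\lambda^*$ and $Ax^*=b$. It is assumed that $\mathcal S\neq\emptyset$. A solution of the system means a pair $(x,\lambda)$ of continuously differentiable functions on $[t_0,+\infty)$ whose derivatives $\dot x,\dot\lambda$ are locally absolutely continuous and which satisfies both relations for almost every $t\ge t_0$. *)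

(* Defs.v *)
From HB Require Import structures.
From mathcomp Require Import all_boot all_order all_algebra.
From mathcomp Require Import all_classical all_reals all_analysis.

Set Implicit Arguments.
Unset Strict Implicit.
Unset Printing Implicit Defensive.

Import Order.TTheory GRing.Theory Num.Theory.
Import numFieldNormedType.Exports.

Local Open Scope classical_set_scope.
Local Open Scope ring_scope.

(* Makes t -> +oo usable as the filter of the =O_ notation. *)
Canonical pinfty_filter_on (R : numFieldType) :=
  FilterType (pinfty_nbhs R) (@filter_filter _ _ proper_pinfty_nbhs).

(* Positivity and definiteness of the inner product follow from inner_normE,
   and completeness is inherited from completeNormedModType. *)
HB.mixin Record isHilbert (R : realType) H of CompleteNormedModule R H := {
  inner : H -> H -> R ;
  innerC : forall x y, inner x y = inner y x ;
  innerP : forall (a : R) x y z,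
    inner (a *: x + y) z = a * inner x z + inner y z ;
  inner_normE : forall x, inner x x = `|x| ^+ 2
}.

#[short(type="hilbertType")]
HB.structure Definition Hilbert (R : realType) :=
  {H of isHilbert R H & CompleteNormedModule R H}.

Section convex_analysis.
Context {R : realType} {H G : hilbertType R}.

Definition is_gradient (f : H -> R) (df : H -> H) :=
  forall x, differentiable f x /\ forall h, 'd f x h = inner (df x) h.

Definition is_adjoint (A : H -> G) (As : G -> H) :=
  forall x y, inner (A x) y = inner x (As y).

Definition proper_function (h : H -> \bar R) :=
  (exists x, (h x < +oo)%E) /\ (forall x, (-oo < h x)%E).

Definition subdifferential (g : H -> R) (x : H) : set H :=
  [set v | forall y, g x + inner v (y - x) <= g y].

End convex_analysis.

Section augmented_Lagrangian.
Context {R : realType} {H G : hilbertType R}.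
Variables (f g : H -> R) (df : H -> H) (A : H -> G) (As : G -> H) (b : G).
Variable rho : R.

Definition augL (x : H) (l : G) : R :=
  f x + g x + inner l (A x - b) + rho / 2 * `|A x - b| ^+ 2.

Definition subdiff_x_augL (x : H) (l : G) : set H :=
  [set df x + v + As l + rho *: As (A x - b) | v in subdifferential g x].

Definition grad_l_augL (x : H) (l : G) : G := A x - b.

Definition saddle_points : set (H * G) :=
  [set p | forall x l, augL p.1 l <= augL p.1 p.2 <= augL x p.2].

End augmented_Lagrangian.

Section calculus_on_a_half_line.
Context {R : realType} {V : normedModType R}.

(* The derivative of the restriction of u to I: one-sided at an endpoint of I
   that belongs to I, and independent of the values of u outside I. *)
Definition diff_quot (u : R -> V) (t s : R) : V := (s - t)^-1 *: (u s - u t).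

Definition derivable_on (I : set R) (u : R -> V) (t : R) :=
  cvg (diff_quot u t @ within I t^').

Definition derive_on (I : set R) (u : R -> V) (t : R) : V :=
  lim (diff_quot u t @ within I t^').

Definition C1_on (I : set R) (u : R -> V) :=
  (forall t, I t -> derivable_on I u t) /\
  {within I, continuous (derive_on I u)}.

Definition abs_continuous (a b : R) (u : R -> V) :=
  forall e, 0 < e -> exists2 d, 0 < d &
    forall n (l r : 'I_n -> R),
      (forall i, a <= l i /\ l i <= r i /\ r i <= b) ->
      trivIset setT (fun i => `]l i, r i[%classic) ->
      \sum_(i < n) (r i - l i) < d ->
      \sum_(i < n) `|u (r i) - u (l i)| < e.

Definition loc_abs_continuous (t0 : R) (u : R -> V) :=
  forall a b, t0 <= a -> a <= b -> abs_continuous a b u.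

End calculus_on_a_half_line.

(* (x, l) solves on [t0, +oo[ the system
     x'' + (alpha / t) x' + beta(t) d_x L_rho(x, l + t / (alpha - 1) l') \ni 0,
     l'' + (alpha / t) l' - beta(t) d_l L_rho(x + t / (alpha - 1) x', l) = 0.
   That the equations hold at t includes that x'' and l'' exist at t. *)
Definition is_solution {R : realType} {H G : hilbertType R}
    (g : H -> R) (df : H -> H) (A : H -> G) (As : G -> H) (b : G)
    (rho alpha t0 : R) (beta : R -> R) (x : R -> H) (l : R -> G) :=
  let I : set R := `[t0, +oo[%classic in
  let x' := derive_on I x in
  let l' := derive_on I l in
  [/\ C1_on I x, C1_on I l,
      loc_abs_continuous t0 x', loc_abs_continuous t0 l' &
      {ae @lebesgue_measure R, forall t, I t ->
        [/\ derivable_on I x' t,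
            derivable_on I l' t,
            [set derive_on I x' t + (alpha / t) *: x' t + beta t *: xi | xi in
               subdiff_x_augL g df A As b rho
                 (x t) (l t + (t / (alpha - 1)) *: l' t)] 0 &
            derive_on I l' t + (alpha / t) *: l' t
              - beta t *: grad_l_augL A b
                  (x t + (t / (alpha - 1)) *: x' t) (l t) = 0]}].

(* Main.v *)
Require Import Defs.
From mathcomp Require Import all_boot all_order all_algebra.
From mathcomp Require Import all_classical all_reals all_analysis.
From mathcomp Require Import ring lra.

(** Put [Phi := L_rho(., ls) - L_rho(xs, ls)], which is nonnegative, and
      [E(t) := t^2 beta(t) Phi(x(t)) + |V(t)|^2 / 2 + |W(t)|^2 / 2] with
      [V := (alpha - 1) (x - xs) + t x'] and [W := (alpha - 1) (l - ls) + t l'].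
    Multiplied by [t], the system gives [V'] and [W'], and the extrapolated
    arguments of the partial gradients are, up to the translation by the saddle
    point, [W / (alpha - 1)] and [V / (alpha - 1)].  Hence the terms that couple
    the primal and the dual variables cancel in [E'].  With [zeta] the element
    of the subdifferential of [Phi] at [x(t)] that the inclusion provides, what
    is left is
      [E' = (2 t beta + t^2 beta') Phi - (alpha - 1) t beta <zeta, x - xs>].
    The penalty makes the subgradient inequality strong in the direction of [A],
    [Phi + rho / 2 |A x - b|^2 <= <zeta, x - xs>], so that
      [E' <= - ((alpha - 3) t beta - t^2 beta') Phi
             - (alpha - 1) rho / 2 t beta |A x - b|^2]
    ([energy_derivative_le]).  The growth condition on [beta] says that both
    terms on the right are nonpositive.  Therefore [E] is bounded and the two
    integrals converge ([dissipation_integral]).  The bound on [E] is the rate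
    for [Phi]; a saddle point minimizes the Lagrangian even without its penalty,
    so [Phi >= rho / 2 |A x - b|^2] ([saddle_gap_ge]), which is the rate of
    feasibility; and [f + g] differs from the Lagrangian by [<ls, A x - b>] and
    the penalty.

    The analytic difficulty is that [g] is nonsmooth: the curve [g o x] need not
    be differentiable at a time where the inclusion holds, so that [E'] may not
    exist there.  Slopes of [E] to the left are enough.  For [s < t] a
    subgradient [v] of [g] at [x(t)] gives
    [g(x(t)) - g(x(s)) <= <v, x(t) - x(s)>], and the squared norms satisfy the
    same kind of inequality, so the left slopes of [E] are bounded by a quantity
    converging to the value of [E'] above ([energy_left_slope]).  An absolutely
    continuous function whose left slopes are almost everywhere nonpositive in
    the limit is nonincreasing ([abs_continuous_nonincreasing]): this uses only
    an induction on the real line and the outer regularity of the Lebesgue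
    measure.

    Finally [E] is absolutely continuous on compact intervals because [x'] and
    [l'] are and because [Phi o x] is Lipschitz there.  The latter holds since a
    finite convex lower semicontinuous function on a complete space is locally
    Lipschitz, by the Baire category theorem ([lsc_convex_locally_lipschitz]). *)

Set Implicit Arguments.
Unset Strict Implicit.
Unset Printing Implicit Defensive.
Import Order.TTheory GRing.Theory Num.Theory.
Import numFieldNormedType.Exports.
Local Open Scope classical_set_scope.
Local Open Scope ring_scope.

(** * Real induction and one-sided calculus on an interval *)

Section real_line.
Context {R : realType}.
Implicit Types (a b c s t r : R).

(** Real induction from the right end of an interval.  The step only looks to the
    left of a point, which is where one-sided information will be available; the
    right of a point enters through a limit. *)
Lemma backward_induction a b (P : R -> Prop) :
  a <= b -> P b ->
  (forall s, a < s -> s <= b -> P s ->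
     exists2 c, c < s & forall r, a <= r -> c < r -> r < s -> P r) ->
  (forall s, a <= s -> s < b ->
     (forall c, s < c -> exists r, [/\ s < r, r < c, r <= b & P r]) -> P s) ->
  P a.
Proof.
move=> ab Pb Pleft Plim.
pose S := [set c | a <= c <= b /\ P c].
have Sb : S b by split => //; rewrite ab lexx.
have lS : has_lbound S by exists a => c [/andP[]].
have S0 : S !=set0 by exists b.
have ha : a <= inf S by apply: lb_le_inf => // c [/andP[]].
have hb : inf S <= b by apply: ge_inf.
have Ps : P (inf S).
  apply: contrapT => nP.
  have nb : inf S < b.
    by rewrite lt_neqAle hb andbT; apply/eqP => E; apply: nP; rewrite E.
  apply: (nP); apply: Plim => // c sc.
  have [r [/andP[ar rb] Pr] rc] := inf_lt S0 sc.
  exists r; split => //; rewrite lt_neqAle ge_inf// ?andbT; last by split; rewrite ?ar.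
  by apply/eqP => E; apply: nP; rewrite E.
have [->//|anS] := eqVneq a (inf S).
have aS : a < inf S by rewrite lt_neqAle anS.
have [c cS Pc] := Pleft _ aS hb Ps.
pose r := (Num.max a c + inf S) / 2.
have mS : Num.max a c < inf S by rewrite gt_max aS.
have rS : r < inf S by rewrite /r; lra.
have mr : Num.max a c < r by rewrite /r; lra.
move: mr; rewrite gt_max => /andP[ar cr].
suff : inf S <= r by rewrite leNgt rS.
apply: ge_inf => //; split; last exact: Pc (ltW ar) cr rS.
by rewrite (ltW ar) (le_trans (ltW rS)).
Qed.

Lemma near_left (I : set R) t (Q : R -> Prop) :
  (\forall s \near within I t^', Q s) ->
  exists2 c, c < t & forall r, I r -> c < r -> r < t -> Q r.
Proof.
rewrite near_withinE /dnbhs near_withinE => /nbhs_ballP[d /= d0 dQ].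
exists (t - d); first by rewrite ltrBlDr ltrDl.
move=> r Ir dr rt; apply: dQ => //; last by rewrite lt_eqF.
rewrite /ball/= gtr0_norm ?subr_gt0//; lra.
Qed.

Lemma near_within_ball (I : set R) t (Q : R -> Prop) :
  (\forall s \near within I (nbhs t), Q s) ->
  exists2 d, 0 < d & forall r, I r -> `|r - t| < d -> Q r.
Proof.
rewrite near_withinE => /nbhs_ballP[d /= d0 dQ].
exists d => // r Ir dr; apply: dQ => //.
by rewrite /ball/= distrC.
Qed.

Lemma within_continuousP {V : normedModType R} (I : set R) (u : R -> V) :
  {within I, continuous u} <->
  forall t, I t -> forall e, 0 < e ->
    exists2 d, 0 < d & forall s, I s -> `|s - t| < d -> `|u s - u t| < e.
Proof.
split.
  move/subspace_continuousP => cu t It e e0.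
  have /cvgrPdist_lt/(_ e e0)/near_within_ball[d d0 dP] := cu _ It.
  by exists d => // s Is /dP; rewrite distrC; exact.
move=> H; apply/subspace_continuousP => t It.
apply/cvgrPdist_lt => e e0; have [d d0 dP] := H _ It _ e0.
rewrite near_withinE; apply/nbhs_ballP; exists d => //= s ts Is.
by rewrite distrC; apply: dP => //; rewrite distrC.
Qed.

Lemma within_continuous_comp {V W : normedModType R} (I : set R) (u : R -> V) (P : V -> W) :
  {within I, continuous u} -> continuous P -> {within I, continuous (fun t => P (u t))}.
Proof.
move=> /subspace_continuousP cu cP; apply/subspace_continuousP => t It.
exact: (cvg_comp _ _ (cu t It) (cP (u t))).
Qed.

Lemma within_continuous_cvg {V : normedModType R} (I : set R) (u : R -> V) t :
  {within I, continuous u} -> I t -> u s @[s --> within I t^'] --> u t.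
Proof.
move=> /subspace_continuousP cu It.
have /cvgrPdist_lt c1 := cu t It.
apply/cvgrPdist_lt => e e0; have := c1 e e0.
rewrite !near_withinE; apply: filterS => s h _.
exact: h.
Qed.

Lemma within_continuous_bounded {V : normedModType R} a b (u : R -> V) :
  {within `[a, b], continuous u} ->
  exists2 M, 0 <= M & forall t, a <= t -> t <= b -> `|u t| <= M.
Proof.
move=> cu; have [ab|ba] := leP a b; last first.
  by exists 0 => // t /le_trans/[apply]; rewrite leNgt ba.
have cn : {within `[a, b], continuous (fun t => `|u t|)}.
  apply/within_continuousP => t It e e0.
  have /within_continuousP/(_ _ It _ e0)[d d0 dP] := cu.
  by exists d => // s Is /(dP _ Is); apply: le_lt_trans; exact: ler_dist_dist.
have [c _ cM] := EVT_max ab cn.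
by exists `|u c| => // t at' tb; apply: cM; rewrite in_itv/= at'.
Qed.

Lemma derivable_on_continuous {V : normedModType R} (I : set R) (u : R -> V) :
  (forall t, I t -> derivable_on I u t) -> {within I, continuous u}.
Proof.
move=> du; apply/subspace_continuousP => t It.
have du' : diff_quot u t s @[s --> within I t^'] --> derive_on I u t by exact: du.
have c1 : (s - t) *: diff_quot u t s + u t @[s --> within I t^'] --> u t.
  rewrite -[X in _ --> X]add0r -(scale0r (derive_on I u t)) -(subrr t).
  apply: cvgD; last exact: cvg_cst.
  apply: cvgZ => //; apply: cvgB; last exact: cvg_cst.
  apply: cvg_within_filter.
  by apply: cvg_within_filter; exact: cvg_id.
apply/cvgrPdist_lt => e e0.
move/cvgrPdist_lt/(_ e e0): c1.
rewrite near_withinE /dnbhs near_withinE near_withinE.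
apply: filterS => s H Is; have [->|st] := eqVneq s t; first by rewrite subrr normr0.
move: (H st Is); rewrite /diff_quot scalerA divff ?subr_eq0// scale1r.
by rewrite subrK.
Qed.

(** Mean value inequality for vector-valued functions.  Slopes to the left of
    each point are enough, by real induction, and continuity closes the limit
    step. *)
Lemma left_slope_bound {V : normedModType R} a b M (u : R -> V) :
  a <= b -> {within `[a, b], continuous u} ->
  (forall s, a < s -> s <= b ->
     exists2 c, c < s & forall r, a <= r -> c < r -> r < s -> `|u s - u r| <= M * (s - r)) ->
  `|u b - u a| <= M * (b - a).
Proof.
move=> ab /within_continuousP cu H.
apply: (backward_induction (P := fun c => `|u b - u c| <= M * (b - c)) ab).
- by rewrite !subrr normr0 mulr0.
- move=> s as' sb Ps; have [c cs cP] := H _ as' sb.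
  exists c => // r ar cr rs.
  have -> : u b - u r = (u b - u s) + (u s - u r) by rewrite addrA subrK.
  apply: le_trans (ler_normD _ _) _.
  apply: le_trans (lerD Ps (cP r ar cr rs)) _; lra.
- move=> s as' sb Hs; apply/ler_addgt0Pl => e e0.
  have sI : `[a, b]%classic s by rewrite /= in_itv/= as' ltW.
  have e20 : 0 < e / 2 by lra.
  have [d d0 dP] := cu _ sI _ e20.
  (* within k of s both u and the affine bound move by at most e / 2 *)
  pose k := Num.min d (e / 2 / (`|M| + 1)).
  have M0 : 0 < `|M| + 1 by rewrite ltr_wpDl.
  have k0 : 0 < k by rewrite lt_min d0 divr_gt0.
  have [r [sr rk rb Pr]] := Hs (s + k) ltac:(lra).
  have rI : `[a, b]%classic r by rewrite /= in_itv/= rb andbT; lra.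
  have : r - s < k by lra.
  rewrite lt_min => /andP[rsd rse].
  have := dP _ rI; rewrite gtr0_norm ?subr_gt0// => /(_ rsd) urs.
  have -> : u b - u s = (u b - u r) + (u r - u s) by rewrite addrA subrK.
  apply: le_trans (ler_normD _ _) _.
  apply: le_trans (lerD Pr (ltW urs)) _.
  move: rse; rewrite ltr_pdivlMr// => rse.
  have : - (M * (r - s)) <= `|M| * (r - s).
    by rewrite -mulNr ler_wpM2r ?subr_ge0 ?(ltW sr)// ler_normr lexx orbT.
  nra.
Qed.

(** The derivative is bounded on the compact interval, and near a point the left
    slopes exceed its norm by less than one. *)
Lemma C1_on_lipschitz {V : normedModType R} (I : set R) a b (u : R -> V) :
  (forall t, a <= t -> t <= b -> I t) -> C1_on I u ->
  exists2 M, 0 <= M & forall s t, a <= s -> s <= t -> t <= b ->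
    `|u t - u s| <= M * (t - s).
Proof.
move=> abI [du cu].
have subI : `[a, b] `<=` I by move=> t /=; rewrite in_itv/= => /andP[]; exact: abI.
have [M M0 MP] := within_continuous_bounded (continuous_subspaceW subI cu).
have cI := derivable_on_continuous du.
exists (M + 1); first by lra.
move=> s t as' st tb; apply: left_slope_bound => //.
  apply: continuous_subspaceW cI => r /=; rewrite in_itv/= => /andP[sr rt].
  by apply: abI; lra.
move=> r sr rt.
have Ir : I r by apply: abI; lra.
have dr : diff_quot u r q @[q --> within I r^'] --> derive_on I u r by exact: du.
have /cvgrPdist_lt/(_ 1 ltr01)/near_left[c cr cP] := dr.
exists c => // q sq cq qr.
have Iq : I q by apply: abI; lra.
have := cP q Iq cq qr => /ltW dle.
have -> : u r - u q = (r - q) *: diff_quot u r q.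
  by rewrite /diff_quot scalerA -[r - q]opprB mulNr divff ?subr_eq0 ?lt_eqF// scaleN1r opprB.
rewrite normrZ gtr0_norm ?subr_gt0// mulrC ler_wpM2r ?subr_ge0 ?(ltW qr)//.
have -> : diff_quot u r q = derive_on I u r - (derive_on I u r - diff_quot u r q).
  by rewrite subKr.
apply: le_trans (ler_normB _ _) _; apply: lerD => //; apply: MP; lra.
Qed.

(** The compactness of the interval enters through real induction: the property
    carried to the left is the existence of some constant on the interval
    from [c] to [b], and two constants are merged into their maximum at each
    step. *)
Lemma locally_lipschitz_itv {V : normedModType R} a b (u : R -> V) :
  a <= b ->
  (forall s, a <= s -> s <= b -> exists2 d, 0 < d & exists2 M, 0 <= M &
    forall r q, a <= r -> r <= q -> q <= b -> s - d < r -> q < s + d ->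
      `|u q - u r| <= M * (q - r)) ->
  exists2 M, 0 <= M & forall s t, a <= s -> s <= t -> t <= b ->
    `|u t - u s| <= M * (t - s).
Proof.
move=> ab H.
pose P c := exists2 M, 0 <= M & forall s t, c <= s -> s <= t -> t <= b ->
    `|u t - u s| <= M * (t - s).
have glue s r d M : a <= r -> r <= s -> s <= b -> s - d < r ->
    0 <= M -> (forall r q, a <= r -> r <= q -> q <= b -> s - d < r -> q < s + d ->
      `|u q - u r| <= M * (q - r)) ->
    forall q, r <= q -> q < s + d -> q <= b -> P q -> P r.
  move=> ar rs sb sdr M0 MP q rq qd qb [M' M'0 M'P].
  have le1 : M <= Num.max M M' by rewrite le_max lexx.
  have le2 : M' <= Num.max M M' by rewrite le_max lexx orbT.
  have up (x y z : R) : x <= y -> y <= Num.max M M' -> 0 <= z -> x * z <= Num.max M M' * z.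
    by move=> xy yM z0; rewrite ler_wpM2r// (le_trans xy).
  exists (Num.max M M'); first exact: le_trans le1.
  move=> p t rp pt tb.
  have [qp|pq] := leP q p.
    by apply: le_trans (M'P _ _ qp pt tb) _; apply: (up _ M') => //; lra.
  have [tq|qt] := leP t q.
    apply: (le_trans (MP p t _ _ _ _ _)); try lra.
    by apply: (up _ M) => //; lra.
  have -> : u t - u p = (u t - u q) + (u q - u p) by rewrite addrA subrK.
  apply: le_trans (ler_normD _ _) _.
  have h1 : `|u t - u q| <= Num.max M M' * (t - q).
    apply: (le_trans (M'P _ _ _ _ _)); try lra.
    by apply: (up _ M') => //; lra.
  have h2 : `|u q - u p| <= Num.max M M' * (q - p).
    apply: (le_trans (MP _ _ _ _ _ _ _)); try lra.
    by apply: (up _ M) => //; lra.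
  lra.
apply: (backward_induction (P := P) ab).
- exists 0 => // s t bs st tb.
  have -> : t = s by lra.
  by rewrite !subrr normr0 mul0r.
- move=> s as' sb Ps; have [d d0 [M M0 MP]] := H s (ltW as') sb.
  exists (s - d); first by lra.
  by move=> r ar cr rs; apply: (glue s r d M _ _ _ _ _ MP s) => //; lra.
- move=> s as' sb Hs; have [d d0 [M M0 MP]] := H s as' (ltW sb).
  have [r [sr rk rb Pr]] := Hs (s + d) ltac:(lra).
  by apply: (glue s s d M _ _ _ _ _ MP r) => //; lra.
Qed.

End real_line.

Section differences.
Context {R : realType} {V : normedModType R}.

Lemma diff_quotE (u : R -> V) (t s : R) : s != t -> u t - u s = (t - s) *: diff_quot u t s.
Proof.
move=> st; rewrite /diff_quot scalerA -[t - s]opprB mulNr divff ?subr_eq0//.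
by rewrite scaleN1r opprB.
Qed.

(** A bound on the increments of [E] by a convergent function [Q] gives the left
    slope condition consumed by the dissipation lemmas. *)
Lemma left_slope_le (I : set R) (t h q : R) (E Q : R -> R) :
  (forall s, I s -> s < t -> E t - E s <= (t - s) * Q s) ->
  Q s @[s --> within I t^'] --> q -> q <= - h ->
  forall e, 0 < e -> exists2 c, c < t & forall s, I s -> c < s -> s < t ->
    E t - E s <= (e - h) * (t - s).
Proof.
move=> EQ Qq qh e e0.
move/cvgrPdist_lt/(_ e e0)/near_left: Qq => [c ct cP].
exists c => // s Is cs st; apply: le_trans (EQ s Is st) _.
rewrite mulrC ler_wpM2r ?subr_ge0 ?(ltW st)//.
have := cP s Is cs st; rewrite ltr_norml => /andP[? ?]; lra.
Qed.

End differences.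

(** * Absolutely continuous functions *)

Section ac.
Context {R : realType}.
Implicit Types (a b c s t r : R).
Let mu : measure _ _ := @lebesgue_measure R.

(** The closure of absolute continuity under sums, products and norms below is
    obtained by dominating increments. *)
Lemma abs_continuous_dominated {V V1 V2 : normedModType R} a b C (u : R -> V)
    (v : R -> V1) (w : R -> V2) :
  0 <= C -> abs_continuous a b v -> abs_continuous a b w ->
  (forall s t, a <= s -> s <= t -> t <= b ->
     `|u t - u s| <= C * (`|v t - v s| + `|w t - w s|)) ->
  abs_continuous a b u.
Proof.
move=> C0 acv acw dom e e0.
pose k := e / (2 * (C + 1)).
have k0 : 0 < k by rewrite divr_gt0// mulr_gt0//; lra.
have [d1 d10 h1] := acv _ k0; have [d2 d20 h2] := acw _ k0.
exists (Num.min d1 d2); first by rewrite lt_min d10.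
move=> n l r lr tlr; rewrite lt_min => /andP[s1 s2].
have := h1 n l r lr tlr s1; have := h2 n l r lr tlr s2 => B A.
apply: (@le_lt_trans _ _ (C * (\sum_(i < n) `|v (r i) - v (l i)| + \sum_(i < n) `|w (r i) - w (l i)|))).
  rewrite -big_split mulr_sumr; apply: ler_sum => i _.
  by have [? [? ?]] := lr i; exact: dom.
have ek : e = (C + 1) * (k + k).
  by rewrite /k; field; rewrite gt_eqF//; lra.
rewrite ek; nra.
Qed.

Lemma abs_continuous_lipschitz {V : normedModType R} a b M (u : R -> V) :
  0 <= M -> (forall s t, a <= s -> s <= t -> t <= b -> `|u t - u s| <= M * (t - s)) ->
  abs_continuous a b u.
Proof.
move=> M0 uM e e0; exists (e / (M + 1)); first by rewrite divr_gt0//; lra.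
move=> n l r lr _; rewrite ltr_pdivlMr; last by lra.
move=> sl; apply: le_lt_trans sl; rewrite mulrC.
have S0 : 0 <= \sum_(i < n) (r i - l i).
  by apply: sumr_ge0 => i _; rewrite subr_ge0; have [_ []] := lr i.
apply: (@le_trans _ _ (M * \sum_(i < n) (r i - l i))).
  rewrite mulr_sumr; apply: ler_sum => i _.
  by have [? [? ?]] := lr i; exact: uM.
nra.
Qed.

Lemma abs_continuous_uniform {V : normedModType R} a b (u : R -> V) :
  abs_continuous a b u -> forall e, 0 < e -> exists2 d, 0 < d &
    forall s t, a <= s -> s <= t -> t <= b -> t - s < d -> `|u t - u s| < e.
Proof.
move=> acu e e0; have [d d0 dP] := acu _ e0.
exists d => // s t as' st tb std.
have := dP 1%N (fun=> s) (fun=> t).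
rewrite !big_ord1; apply => // i j _ _ _.
by rewrite !ord1.
Qed.

Lemma abs_continuous_within_continuous {V : normedModType R} a b (u : R -> V) :
  abs_continuous a b u -> {within `[a, b], continuous u}.
Proof.
move=> /abs_continuous_uniform acu; apply/within_continuousP => t /=.
rewrite in_itv/= => /andP[at' tb] e e0; have [d d0 dP] := acu _ e0.
exists d => // s; rewrite /= in_itv/= => /andP[as' sb] std.
have [st|ts] := leP s t.
  by rewrite distrC; apply: dP => //; move: std; rewrite ler0_norm; lra.
by apply: dP => //; [lra|move: std; rewrite gtr0_norm; lra].
Qed.

(** The families of intervals over which absolute continuity is tested.  Lists
    of pairs of endpoints ordered from left to right are convenient because real
    induction extends a family by one interval at its left end. *)
Definition increasing_family c b (s : seq (R * R)) :=
  [/\ forall p, p \in s -> c <= p.1, forall p, p \in s -> p.1 <= p.2,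
      forall p, p \in s -> p.2 <= b &
      pairwise (fun p q : R * R => p.2 <= q.1) s].

Lemma increasing_family_trivIset c b (s : seq (R * R)) :
  increasing_family c b s ->
  trivIset [set: 'I_(size s)]
    (fun i => `](nth (0, 0) s i).1, (nth (0, 0) s i).2[%classic).
Proof.
move=> [_ _ _ /(pairwiseP (0, 0)) ps] i j _ _ [z []].
rewrite /= !in_itv/= => /andP[iz zi] /andP[jz zj].
apply/val_inj; have [ij|ji|//] := ltngtP (val i) (val j).
  exfalso; have {ps ij} := ps i j (ltn_ord i) (ltn_ord j) ij; lra.
exfalso; have {ps ji} := ps j i (ltn_ord j) (ltn_ord i) ji; lra.
Qed.

(** The total length is the measure of the union, which is contained in [U]. *)
Lemma increasing_family_length c b (s : seq (R * R)) (U : set R) :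
  increasing_family c b s -> open U ->
  (forall p, p \in s -> `]p.1, p.2[ `<=` U) ->
  ((\sum_(i < size s) ((nth (0, 0) s i).2 - (nth (0, 0) s i).1))%:E <= mu U)%E.
Proof.
move=> fs oU sU; have ts := increasing_family_trivIset fs.
have [_ s12 _ _] := fs.
set F := fun i : 'I_(size s) => `](nth (0, 0) s i).1, (nth (0, 0) s i).2[%classic.
have -> : (\sum_(i < size s) ((nth (0, 0) s i).2 - (nth (0, 0) s i).1))%:E =
    mu (\bigcup_(i in [set: 'I_(size s)]) F i).
  rewrite measure_fin_bigcup//; [|exact: finite_finset|by move=> i _; exact: measurable_itv].
  have -> : [set: 'I_(size s)] = [set` index_enum 'I_(size s)].
    by apply/seteqP; split => // i _ /=; rewrite mem_index_enum.
  rewrite -fsbig_seq ?index_enum_uniq// -sumEFin; apply: eq_bigr => i _.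
  rewrite [RHS](lebesgue_measure_itv `](nth (0, 0) s i).1, (nth (0, 0) s i).2[).
  rewrite /= lte_fin.
  have := s12 _ (mem_nth (0, 0) (ltn_ord i)); rewrite le_eqVlt => /predU1P[->|->].
    by rewrite ltxx subrr.
  by rewrite EFinB.
apply: (@le_measure _ _ _ mu); rewrite ?inE.
- by apply: fin_bigcup_measurable => [|i _]; [exact: finite_finset|exact: measurable_itv].
- exact: measurable_realfun.open_measurable.
- by apply: bigcup_sub => i _; apply: sU; rewrite mem_nth.
Qed.

(** Cover the exceptional set [N] by an open set [U] of small measure, and go
    from [b] to [a] by real induction.  At a point outside [N] the increment of
    [K] is controlled by the slope; at a point of [N] an interval inside [U] is
    added to a finite family, and the increment of [K] is charged to that family.
    At the end the family has small total length, so by absolute continuity its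
    contribution is small too.  Slopes to the left suffice because the induction
    never looks to the right of a point except by continuity. *)
Lemma abs_continuous_nonincreasing a b (K : R -> R) (N : set R) :
  a <= b -> abs_continuous a b K -> mu.-negligible N ->
  (forall t, a < t -> t <= b -> ~ N t -> forall e, 0 < e ->
     exists2 c, c < t & forall s, a <= s -> c < s -> s < t -> K t - K s <= e * (t - s)) ->
  K b <= K a.
Proof.
move=> ab acK negN slope.
(* e (b - a) for the slopes, e for the limit steps, e for the family *)
suff key e : 0 < e -> K b - K a <= e * (b - a + 2).
  have ba : 0 < b - a + 2 by lra.
  rewrite -subr_le0; apply/ler_addgt0Pl => e e0; rewrite addr0.
  have -> : e = e / (b - a + 2) * (b - a + 2) by rewrite mulfVK// gt_eqF.
  by apply: key; rewrite divr_gt0.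
move=> e0.
have [d d0 dP] := acK _ e0.
have d20 : 0 < d / 2 by lra.
have [U [oU NU]] := outer_measure_open_le N d20.
rewrite (negligible_outer_measure N).1// add0e => muU.
pose P c := forall eta, 0 < eta -> exists s : seq (R * R),
  [/\ increasing_family c b s, (forall p, p \in s -> `]p.1, p.2[ `<=` U) &
      K b - K c <= e * (b - c) + eta + \sum_(p <- s) `|K p.2 - K p.1|].
suff /(_ _ e0)[s [fs sU sK]] : P a.
  have small : \sum_(p <- s) `|K p.2 - K p.1| < e.
    rewrite (big_nth (0, 0)) big_mkord; apply: dP.
    - move=> i; have [h1 h2 h3 _] := fs.
      by have si := mem_nth (0, 0) (ltn_ord i); rewrite h1 ?h2 ?h3.
    - exact: increasing_family_trivIset fs.
    - rewrite -lte_fin.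
      apply: le_lt_trans (increasing_family_length fs oU sU) _.
      by apply: le_lt_trans muU _; rewrite lte_fin; lra.
  lra.
apply: (backward_induction (P := P) ab).
- move=> eta eta0; exists [::]; split => //; rewrite big_nil !subrr; lra.
- move=> s as' sb Ps.
  have [Ns|nNs] := pselect (N s).
    have /nbhs_ballP[r /= r0 rU] : nbhs s U by apply: open_nbhs_nbhs; split => //; exact: NU.
    exists (s - r); first by lra.
    move=> q aq sq qs eta eta0; have [F [[f1 f2 f3 f4] FU FK]] := Ps _ eta0.
    exists ((q, s) :: F); split.
    + split=> [p|p|p|/=]; rewrite ?inE.
      * by case/predU1P => [->//|/f1]; lra.
      * by case/predU1P => [->/=|/f2//]; lra.
      * by case/predU1P => [->//|/f3].
      * by rewrite f4 andbT; apply/allP => p /f1.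
    + move=> p; rewrite inE => /predU1P[->/=|/FU//] z.
      rewrite /= in_itv/= => /andP[qz zs]; apply: rU.
      by rewrite /ball/= gtr0_norm; lra.
    + rewrite big_cons/=.
      have : K s - K q <= `|K s - K q| by exact: ler_norm.
      nra.
  have [c cs cP] := slope _ as' sb nNs _ e0.
  exists c => // q aq cq qs eta eta0; have [F [[f1 f2 f3 f4] FU FK]] := Ps _ eta0.
  exists F; split => //; first by split => // p /f1; lra.
  have := cP q aq cq qs; nra.
- move=> s as' sb Hs eta eta0.
  have eta20 : 0 < eta / 2 by lra.
  have [k k0 kP] := abs_continuous_uniform acK eta20.
  have [q [sq qk qb Pq]] := Hs (s + k) ltac:(lra).
  have [F [[f1 f2 f3 f4] FU FK]] := Pq _ eta20.
  exists F; split => //; first by split => // p /f1; lra.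
  have := kP s q as' (ltW sq) qb ltac:(lra).
  move=> /(le_lt_trans (ler_norm _)); nra.
Qed.

End ac.

Section ac_algebra.
Context {R : realType}.
Implicit Types (a b c s t r : R).

Lemma abs_continuous_bounded {V : normedModType R} a b (u : R -> V) :
  abs_continuous a b u ->
  exists2 M, 0 <= M & forall t, a <= t -> t <= b -> `|u t| <= M.
Proof. by move=> /abs_continuous_within_continuous; exact: within_continuous_bounded. Qed.

Lemma abs_continuousD {V : normedModType R} a b (u v : R -> V) :
  abs_continuous a b u -> abs_continuous a b v -> abs_continuous a b (fun t => u t + v t).
Proof.
move=> acu acv; apply: (abs_continuous_dominated (C := 1) _ acu acv) => // s t _ _ _.
by rewrite mul1r opprD addrACA; exact: ler_normD.
Qed.

Lemma abs_continuousZ {V : normedModType R} a b (k : R -> R) (u : R -> V) :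
  abs_continuous a b k -> abs_continuous a b u -> abs_continuous a b (fun t => k t *: u t).
Proof.
move=> ack acu; have [K K0 kK] := abs_continuous_bounded ack.
have [M M0 uM] := abs_continuous_bounded acu.
apply: (abs_continuous_dominated (C := K + M) _ ack acu); first by rewrite addr_ge0.
move=> s t as' st tb.
have -> : k t *: u t - k s *: u s = k t *: (u t - u s) + (k t - k s) *: u s.
  by rewrite scalerBr scalerBl addrA subrK.
apply: le_trans (ler_normD _ _) _; rewrite !normrZ.
have := kK t (le_trans as' st) tb; have := uM s as' (le_trans st tb).
have : 0 <= `|u t - u s| by []. have : 0 <= `|k t - k s| by [].
move=> *; nra.
Qed.

Lemma abs_continuous_cst {V : normedModType R} a b (z : V) :
  abs_continuous a b (fun=> z).
Proof.
by apply: (abs_continuous_lipschitz (lexx 0)) => s t _ _ _; rewrite subrr normr0 mul0r.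
Qed.

Lemma abs_continuous_id a b : abs_continuous a b (fun t : R => t).
Proof.
by apply: (abs_continuous_lipschitz ler01) => s t _ st _; rewrite mul1r ger0_norm ?subr_ge0.
Qed.

Lemma abs_continuous_half_sqnorm {V : normedModType R} a b (u : R -> V) :
  abs_continuous a b u -> abs_continuous a b (fun t => `|u t| ^+ 2 / 2).
Proof.
move=> acu; have acn : abs_continuous a b (fun t => `|u t|).
  apply: (abs_continuous_dominated (C := 1) _ acu acu) => // s t _ _ _.
  by apply: le_trans (ler_dist_dist _ _) _; rewrite mul1r lerDl.
have := abs_continuousZ (abs_continuousZ acn acn) (abs_continuous_cst a b (2^-1 : R)).
by congr abs_continuous; apply/funext => t; rewrite expr2.
Qed.

Lemma C1_on_abs_continuous {V : normedModType R} (I : set R) a b (u : R -> V) :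
  (forall t, a <= t -> t <= b -> I t) -> C1_on I u -> abs_continuous a b u.
Proof.
by move=> abI /(C1_on_lipschitz abI)[M M0 uM]; exact: abs_continuous_lipschitz uM.
Qed.

End ac_algebra.

(** * Dissipation inequalities in integral form *)

Section dissipation.
Context {R : realType}.
Implicit Types (a b c s t r : R).
Let mu : measure _ _ := @lebesgue_measure R.

(** A primitive [H] with the only two properties needed of it: its increments
    lie between those given by lower and upper bounds of [h]. *)
Lemma primitive_itv a b (h : R -> R) :
  {within `[a, b], continuous h} ->
  exists H : R -> R,
    (forall t, a <= t -> t <= b -> (\int[mu]_(x in `[a, t]) (h x)%:E)%E = (H t)%:E) /\
    (forall s t c d, a <= s -> s <= t -> t <= b ->
       (forall r, s <= r -> r <= t -> c <= h r <= d) ->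
       c * (t - s) <= H t - H s <= d * (t - s)).
Proof.
move=> ch; have ih t : t <= b -> mu.-integrable `[a, t] (EFin \o h).
  move=> tb; apply: continuous_compact_integrable; first exact: segment_compact.
  apply: continuous_subspaceW ch => x /=; rewrite !in_itv/= => /andP[-> /=].
  by move/le_trans; apply.
exists (fun t => Rintegral mu `[a, t] h); split.
  move=> t at' tb; rewrite /Rintegral fineK//.
  exact: integrable_fin_num (ih _ tb).
move=> s t c d as' st tb hcd.
have iht := ih t tb.
have ihst : mu.-integrable `]s, t] (EFin \o h).
  apply: integrableS iht => //; apply: subset_itvr; rewrite bnd_simp//.
rewrite Rintegral_itvB ?bnd_simp//.
have muE : mu `]s, t]%classic = (t - s)%:E.
  rewrite [LHS](lebesgue_measure_itv `]s, t])/= lte_fin -EFinB.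
  by case: ltP => // ts; rewrite (@le_anti _ _ s t) ?st ?ts// subrr.
have mst : fine (mu `]s, t]%classic) = t - s by rewrite muE.
have ic (k : R) : mu.-integrable `]s, t] (EFin \o (fun=> k)).
  have : mu.-integrable `[s, t] (EFin \o (fun=> k)).
    apply: continuous_compact_integrable; first exact: segment_compact.
    by apply: continuous_subspaceT => x; exact: cvg_cst.
  by apply: integrableS => //; apply: subset_itvr; rewrite bnd_simp.
have hr r : `]s, t]%classic r -> c <= h r <= d.
  by rewrite /= in_itv/= => /andP[sr rt]; apply: hcd => //; exact: ltW.
rewrite -mst -(Rintegral_cst mu (measurable_itv `]s, t]) c) -(Rintegral_cst mu (measurable_itv `]s, t]) d).
apply/andP; split; apply: le_Rintegral; try exact: measurable_itv;
  try exact: ihst; try exact: ic; by move=> r /hr/andP[].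
Qed.

(** If the left slopes of [E] are at most [- h], those of [E + H], with [H] a
    primitive of [h], are nonpositive in the limit, so [E + H] is nonincreasing. *)
Lemma dissipation_itv t0 (E h : R -> R) b : t0 <= b ->
  abs_continuous t0 b E -> {within `[t0, b], continuous h} ->
  {ae mu, forall t, `[t0, +oo[%classic t -> forall e, 0 < e ->
     exists2 c, c < t & forall s, t0 <= s -> c < s -> s < t ->
       E t - E s <= (e - h t) * (t - s)} ->
  (\int[mu]_(x in `[t0, b]) (h x)%:E <= (E t0 - E b)%:E)%E.
Proof.
move=> tb acE ch slope.
have [H [HI Hslope]] := primitive_itv ch.
have [M M0 hM] := within_continuous_bounded ch.
have acH : abs_continuous t0 b H.
  apply: (abs_continuous_lipschitz M0) => s t s0 st tb'.
  have /andP[h1 h2] : (- M) * (t - s) <= H t - H s <= M * (t - s).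
    apply: Hslope => // r sr rt; rewrite -ler_norml; apply: hM; lra.
  by rewrite ler_norml -mulNr h1 h2.
have acK : abs_continuous t0 b (fun t => E t + H t).
  apply: (abs_continuous_dominated (C := 1) _ acE acH) => // s t _ _ _.
  by rewrite mul1r opprD addrACA; exact: ler_normD.
have H0 : H t0 = 0.
  have := HI t0 (lexx _) tb; rewrite set_itv1 integral_set1 => /esym.
  by case.
suff : E b + H b <= E t0 + H t0 by rewrite H0 addr0 HI// lee_fin; lra.
apply: (@abs_continuous_nonincreasing _ t0 b _ _ tb acK slope).
move=> t tt tb' /contrapT St e e0.
have It : `[t0, +oo[%classic t by rewrite /= in_itv/= andbT ltW.
have e20 : 0 < e / 2 by lra.
have [c ct cP] := St It _ e20.
have It' : `[t0, b]%classic t by rewrite /= in_itv/= tb' ltW.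
have /within_continuousP/(_ _ It' _ e20)[d d0 dP] := ch.
exists (Num.max c (t - d)); first by rewrite gt_max ct; lra.
move=> s s0; rewrite gt_max => /andP[cs sd] st.
have h1 := cP s s0 cs st.
have /andP[_ h2] : (h t - e / 2) * (t - s) <= H t - H s <= (h t + e / 2) * (t - s).
  apply: Hslope => //; first exact: ltW.
  move=> r sr rt.
  have /dP : `[t0, b]%classic r by rewrite /= in_itv/=; apply/andP; split; lra.
  have -> : `|r - t| < d by rewrite ler0_norm; lra.
  by move=> /(_ isT); rewrite ltr_norml => /andP[? ?]; apply/andP; split; lra.
lra.
Qed.

(** On the half-line the integral of [h] from [t0] to [t0 + n] is at most
    [E t0], because [E] is nonnegative; monotone convergence concludes. *)
Lemma dissipation_integral t0 (E h : R -> R) :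
  (forall b, t0 <= b -> abs_continuous t0 b E) ->
  {within `[t0, +oo[, continuous h} ->
  (forall t, t0 <= t -> 0 <= E t) -> (forall t, t0 <= t -> 0 <= h t) ->
  {ae mu, forall t, `[t0, +oo[%classic t -> forall e, 0 < e ->
     exists2 c, c < t & forall s, t0 <= s -> c < s -> s < t ->
       E t - E s <= (e - h t) * (t - s)} ->
  (forall t, t0 <= t -> E t <= E t0) /\
  (\int[mu]_(x in `[t0, +oo[) (h x)%:E < +oo)%E.
Proof.
move=> acE ch E0 h0 slope.
have sub b : `[t0, b] `<=` `[t0, +oo[.
  by move=> x /=; rewrite !in_itv/= andbT => /andP[].
have chb b : {within `[t0, b], continuous h} by exact: continuous_subspaceW ch.
have D b (tb : t0 <= b) := dissipation_itv tb (acE b tb) (chb b) slope.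
split.
  move=> t tt; rewrite -subr_ge0 -lee_fin; apply: le_trans (D t tt).
  apply: integral_ge0 => x /=; rewrite in_itv/= => /andP[tx _].
  by rewrite lee_fin h0.
pose F n := `[t0, t0 + n%:R]%classic.
have UF : \bigcup_n F n = `[t0, +oo[%classic.
  apply/seteqP; split=> [x [n _] /sub//|x /=]; rewrite in_itv/= andbT => tx.
  have [n _ nP] : exists2 n, True & x - t0 <= n%:R.
    by exists (Num.truncn (x - t0)).+1 => //; apply/ltW/truncnS_gt.
  by exists n => //; rewrite /F/= in_itv/= tx; lra.
rewrite -UF.
have cv : (\int[mu]_(x in F i) (h x)%:E)%E @[i --> \oo] --> (\int[mu]_(x in \bigcup_i F i) (h x)%:E)%E.
  apply: (ge0_nondecreasing_set_cvg_integral (mu := mu)).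
  - apply/nondecreasing_seqP => n; rewrite subsetEset => x.
    by rewrite /F/= !in_itv/= => /andP[-> /= xn]; rewrite -natr1; lra.
  - by move=> i; exact: measurable_itv.
  - move=> i; apply/measurable_realfun.measurable_EFinP; apply: measurable_realfun.subspace_continuous_measurable_fun.
      exact: measurable_itv.
    exact: chb.
  - by move=> i x /sub /=; rewrite in_itv/= andbT lee_fin; exact: h0.
rewrite -(cvg_lim _ cv)//.
apply: (@le_lt_trans _ _ (E t0)%:E); last exact: ltry.
apply: lime_le; first by apply/cvg_ex; exists (\int[mu]_(x in \bigcup_i F i) (h x)%:E)%E.
apply: nearW => n.
have tn : t0 <= t0 + n%:R by rewrite lerDl ler0n.
apply: le_trans (D _ tn) _; rewrite lee_fin; have := E0 _ tn; lra.
Qed.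

End dissipation.

(** * Hilbert spaces *)

Section inner_product.
Context {R : realType} {H : hilbertType R}.
Implicit Types x y z : H.

Lemma inner_zerol x : inner 0 x = 0.
Proof.
have := innerP 1 0 0 x; rewrite scaler0 addr0 mul1r => /eqP.
by rewrite -subr_eq subrr eq_sym => /eqP.
Qed.

Lemma inner_addl x y z : inner (x + y) z = inner x z + inner y z.
Proof. by rewrite -[x]scale1r innerP mul1r scale1r. Qed.

Lemma inner_scalel a x z : inner (a *: x) z = a * inner x z.
Proof. by rewrite -[a *: x]addr0 innerP inner_zerol addr0. Qed.

Lemma inner_oppl x z : inner (- x) z = - inner x z.
Proof. by rewrite -scaleN1r inner_scalel mulN1r. Qed.

Lemma inner_addr x y z : inner z (x + y) = inner z x + inner z y.
Proof. by rewrite ![inner z _]innerC inner_addl. Qed.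

Lemma inner_scaler a x z : inner z (a *: x) = a * inner z x.
Proof. by rewrite ![inner z _]innerC inner_scalel. Qed.

Lemma inner_oppr x z : inner z (- x) = - inner z x.
Proof. by rewrite ![inner z _]innerC inner_oppl. Qed.

Lemma inner_zeror x : inner x 0 = 0.
Proof. by rewrite innerC inner_zerol. Qed.

(** Cauchy-Schwarz: square the triangle inequality for [x + y]. *)
Lemma inner_le_norm x y : inner x y <= `|x| * `|y|.
Proof.
have := ler_normD x y => h.
have : `|x + y| ^+ 2 <= (`|x| + `|y|) ^+ 2.
  by rewrite lerXn2r// nnegrE ?addr_ge0.
rewrite -inner_normE inner_addl !inner_addr !inner_normE (innerC y x).
rewrite sqrrD; lra.
Qed.

Lemma normr_inner_le x y : `|inner x y| <= `|x| * `|y|.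
Proof.
rewrite ler_norml inner_le_norm andbT lerNl -inner_oppl.
by rewrite -[`|x|]normrN inner_le_norm.
Qed.

(** The subgradient inequality of the convex function [|.|^2 / 2] at [x]. *)
Lemma half_sqnormB x y : `|x| ^+ 2 / 2 - `|y| ^+ 2 / 2 <= inner x (x - y).
Proof.
have : 0 <= `|x - y| ^+ 2 by rewrite exprn_ge0.
rewrite -!inner_normE !inner_addl !inner_addr !inner_oppl !inner_oppr (innerC y x).
lra.
Qed.

Lemma cvg_inner {T : Type} (F : set_system T) (FF : Filter F) (z : H) (u : T -> H) (v : H) :
  u t @[t --> F] --> v -> inner z (u t) @[t --> F] --> inner z v.
Proof.
move=> uv; apply/cvgrPdist_le => e e0.
have k0 : 0 < e / (`|z| + 1) by rewrite divr_gt0// ltr_wpDl.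
move/cvgrPdist_le/(_ _ k0): uv; apply: filterS => t.
rewrite -inner_oppr -inner_addr => h; apply: le_trans (normr_inner_le _ _) _.
move: h; rewrite ler_pdivlMr ?ltr_wpDl// => h.
have : 0 <= `|v - u t| by []; nra.
Qed.

End inner_product.

(** * Convex functions on Banach spaces *)

Section convex.
Context {R : realType} {H : completeNormedModType R}.
Implicit Types (g : H -> R) (x y z : H).

Definition convex_ineq (g : H -> R) := forall k x y, 0 <= k -> k <= 1 ->
  g (k *: x + (1 - k) *: y) <= k * g x + (1 - k) * g y.

Lemma convex_function_ineq g :
  convex_function [set: convex_lmodType H] g -> convex_ineq g.
Proof.
move=> cg k x y k0 k1.
by have := cg (Itv01 k0 k1) x y; rewrite !inE => /(_ Logic.I Logic.I).
Qed.

(** A point [z] near [x] is the midpoint of the fixed point [2 x - z0] and of a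
    point near [z0], which bounds [g] above near [x]; reflecting [z] through [x]
    turns the upper bound into a lower bound. *)
Lemma convex_bounded_ball_everywhere g z0 r M : convex_ineq g -> 0 < r ->
  (forall z, `|z - z0| < r -> g z <= M) ->
  forall x, exists2 d, 0 < d & exists M', forall z, `|z - x| < d -> `|g z| <= M'.
Proof.
move=> cg r0 gM x.
have half2 : 1 - 2^-1 = 2^-1 :> R by lra.
have h0 : 0 <= 2^-1 :> R by lra.
have h1 : 2^-1 <= 1 :> R by lra.
have d0 : 0 < r / 2 by lra.
exists (r / 2) => //.
pose y := 2 *: x - z0.
pose B := 2^-1 * g y + 2^-1 * M.
have up z : `|z - x| < r / 2 -> g z <= B.
  move=> zx; have -> : z = 2^-1 *: y + (1 - 2^-1) *: (z0 + 2 *: (z - x)).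
    rewrite half2 -scalerDr /y addrA subrK -scalerDr addrCA subrr addr0.
    by rewrite scalerA mulVf ?scale1r// pnatr_eq0.
  apply: le_trans (cg _ _ _ h0 h1) _; rewrite half2 /B lerD2l ler_wpM2l//.
  apply: gM; rewrite addrAC subrr add0r normrZ ger0_norm//; lra.
exists (`|B| + 2 * `|g x|) => z zx.
have h := up _ zx.
have zx' : `|2 *: x - z - x| < r / 2.
  by rewrite scaler_nat mulr2n addrAC addrK distrC.
have h' := up _ zx'.
have := cg 2^-1 z (2 *: x - z) h0 h1.
rewrite half2 -scalerDr addrC subrK scalerA mulVf ?scale1r ?pnatr_eq0// => hm.
have := ler_norm B; have := ler_norm (g x); have := ler_norm (- g x); rewrite normrN.
move=> a1 a2 a3; rewrite ler_norml; apply/andP; split; lra.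
Qed.

Definition locally_lipschitz (g : H -> R) := forall x, exists2 d, 0 < d &
  exists2 C, 0 <= C & forall y z, `|y - x| < d -> `|z - x| < d ->
    `|g z - g y| <= C * `|z - y|.

Lemma locally_lipschitz_continuous (P : H -> R) :
  locally_lipschitz P -> continuous P.
Proof.
move=> lP z; apply/cvgrPdist_lt => e e0; have [d d0 [C C0 LC]] := lP z.
have k0 : 0 < Num.min d (e / (C + 1)) by rewrite lt_min d0 divr_gt0//; lra.
apply/nbhs_ballP; exists (Num.min d (e / (C + 1))) => //= y.
rewrite -ball_normE /= distrC lt_min => /andP[yd ye].
rewrite distrC; apply: le_lt_trans (LC _ _ _ yd) _; first by rewrite subrr normr0.
move: ye; rewrite ltr_pdivlMr; last lra.
have : 0 <= `|y - z| by []. nra.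
Qed.

(** Extend the segment from [y] to [z] beyond [z] by the fixed length [k], up to
    a point [w] that is still in a ball where [g] is bounded by [B].  Convexity
    along this segment bounds the slope between [y] and [z] by [2 B / k]. *)
Lemma convex_locally_lipschitz g z0 r M : convex_ineq g -> 0 < r ->
  (forall z, `|z - z0| < r -> g z <= M) -> locally_lipschitz g.
Proof.
move=> cg r0 gM x.
have [d d0 [B gB]] := convex_bounded_ball_everywhere cg r0 gM x.
have B0 : 0 <= B by apply: le_trans (gB x _); rewrite ?subrr ?normr0.
pose k := d / 2; have k0 : 0 < k by rewrite /k; lra.
exists k => //; exists (2 * B / k); first by rewrite divr_ge0//; [lra|exact: ltW].
have one y z : `|y - x| < k -> `|z - x| < k -> g z - g y <= 2 * B / k * `|z - y|.
  move=> yx zx; have [->|zy] := eqVneq z y; first by rewrite !subrr normr0 mulr0.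
  have n0 : 0 < `|z - y| by rewrite normr_gt0 subr_eq0.
  pose n := `|z - y|.
  pose w := z + (k / n) *: (z - y).
  have wx : `|w - x| < d.
    rewrite /w addrAC; apply: le_lt_trans (ler_normD _ _) _.
    rewrite normrZ ger0_norm ?divr_ge0 ?ltW// -/n divfK ?gt_eqF//.
    by move: zx; rewrite /k; lra.
  pose s := n / (k + n).
  have kn0 : 0 < k + n by rewrite addr_gt0.
  have s0 : 0 <= s by rewrite divr_ge0// ltW.
  have s1 : s <= 1 by rewrite ler_pdivrMr// mul1r lerDr ltW.
  have ez : z = s *: w + (1 - s) *: y.
    rewrite /w scalerDr scalerA.
    have -> : s * (k / n) = 1 - s.
      by rewrite /s; field; rewrite !gt_eqF.
    rewrite -addrA -scalerDr subrK -scalerDl addrC subrK scale1r//.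
  have := cg s w y s0 s1; rewrite -ez => h.
  have yd : `|y - x| < d by move: yx; rewrite /k; lra.
  have := gB _ yd; have := gB _ wx; rewrite !ler_norml => /andP[w1 w2] /andP[y1 y2].
  apply: (@le_trans _ _ (s * (2 * B))); first by nra.
  have -> : 2 * B / k * `|z - y| = n / k * (2 * B) by rewrite /n; ring.
  apply: ler_wpM2r; first by lra.
  apply: ler_wpM2l; first exact: ltW.
  by rewrite lef_pV2 ?posrE// lerDl ltW.
move=> y z yx zx; rewrite ler_norml one// andbT lerNl opprB distrC.
exact: one.
Qed.

Lemma continuous_convex_locally_lipschitz g :
  convex_ineq g -> continuous g -> locally_lipschitz g.
Proof.
move=> cg ctg.
have /cvgrPdist_lt/(_ 1 ltr01)/nbhs_ballP[r /= r0 rP] := ctg 0.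
apply: (@convex_locally_lipschitz g 0 r (g 0 + 1) cg r0) => z; rewrite subr0 => zr.
have : ball 0 r z by rewrite -ball_normE /= sub0r normrN.
by move/rP; rewrite /= ltr_norml => /andP[]; lra.
Qed.

(** The closed sublevel sets [g <= n] cover the space, so by the Baire category
    theorem one of them contains a ball, on which [g] is bounded above. *)
Lemma lsc_convex_locally_lipschitz g :
  convex_ineq g -> lower_semicontinuous (EFin \o g) -> locally_lipschitz g.
Proof.
move=> cg /lower_semicontinuousP lsc.
pose O n := [set x | (n%:R%:E < (EFin \o g) x)%E].
(* otherwise a point would satisfy g > n for every n *)
have [n nD] : exists n, ~ dense (O n).
  apply: contrapT => /forallNP nd.
  have /Baire/(_ setT) : forall n, open (O n) /\ dense (O n).
    by move=> n; split; [exact: lsc|have := nd n; exact: contrapT].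
  case; first by exists 0.
    exact: openT.
  move=> x [_ xO].
  have := xO (Num.truncn (g x)).+1 Logic.I; rewrite /O/= lte_fin.
  by move=> /lt_trans/(_ (truncnS_gt _)); rewrite ltxx.
have [U [[z0 Uz0] oU UO]] : exists U, [/\ U !=set0, open U & U `&` O n = set0].
  apply: contrapT => hn; apply: nD => U U0 oU.
  by apply/set0P/eqP => E; apply: hn; exists U.
have /nbhs_ballP[r /= r0 rU] : nbhs z0 U by apply: open_nbhs_nbhs.
apply: (@convex_locally_lipschitz g z0 r n%:R cg r0) => z zr.
rewrite leNgt; apply/negP => gz.
suff : (U `&` O n) z by rewrite UO.
split; last by rewrite /O/= lte_fin.
by apply: rU; rewrite -ball_normE /= distrC.
Qed.

(** By convexity the difference quotients in the direction [y - x] are at most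
    [g y - g x]. *)
Lemma convex_gradient_ineq g x y : convex_ineq g -> differentiable g x ->
  g x + 'd g x (y - x) <= g y.
Proof.
move=> cg dg.
have /cvg_ex[l /= lP] : derivable g x (y - x) by exact: diff_derivable.
have lE : l = 'd g x (y - x).
  by rewrite -deriveE// /derive (cvg_lim _ lP).
rewrite -lE -lerBrDl.
have : h^-1 *: (g (h *: (y - x) + x) - g x) @[h --> 0^'+] --> l.
  exact: cvg_dnbhs_at_right lP.
move=> /cvgr_to_le; apply.
near=> h.
have h0 : 0 < h by near: h; exact: nbhs_right_gt.
have h1 : h <= 1 by near: h; apply: nbhs_right_le; exact: ltr01.
rewrite /GRing.scale/= ler_pdivrMl//.
have -> : h *: (y - x) + x = h *: y + (1 - h) *: x.
  by rewrite scalerBr scalerBl scale1r addrAC addrA.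
have := cg h y x (ltW h0) h1; lra.
Unshelve. all: by end_near. Qed.

(** Uniformity of the Lipschitz constant along the curve comes from
    [locally_lipschitz_itv]. *)
Lemma abs_continuous_locally_lipschitz_comp (P : H -> R) a b M (x : R -> H) :
  a <= b -> locally_lipschitz P -> 0 <= M ->
  (forall s t, a <= s -> s <= t -> t <= b -> `|x t - x s| <= M * (t - s)) ->
  abs_continuous a b (P \o x).
Proof.
move=> ab lP M0 xM.
suff [C C0 PC] : exists2 C, 0 <= C & forall s t, a <= s -> s <= t -> t <= b ->
    `|P (x t) - P (x s)| <= C * (t - s) by exact: abs_continuous_lipschitz PC.
apply: (locally_lipschitz_itv (u := P \o x) ab) => s as' sb.
have [d d0 [C C0 PC]] := lP (x s).
have dM : 0 < d / (M + 1) by rewrite divr_gt0//; lra.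
have near_xs r : a <= r -> r <= b -> s - d / (M + 1) < r -> r < s + d / (M + 1) ->
    `|x r - x s| < d.
  move=> ar rb sr rs.
  have h : `|r - s| < d / (M + 1) by rewrite ltr_norml; apply/andP; split; lra.
  apply: (@le_lt_trans _ _ (M * `|r - s|)).
    have [le|/ltW le] := leP s r; first by rewrite ger0_norm ?subr_ge0//; exact: xM.
    by rewrite distrC ler0_norm ?subr_le0// opprB; exact: xM.
  move: h; rewrite ltr_pdivlMr; last lra.
  by apply: le_lt_trans; rewrite mulrC ler_wpM2l//; lra.
exists (d / (M + 1)) => //; exists (C * M); first exact: mulr_ge0.
move=> r q ar rq qb sr qs /=.
apply: (le_trans (PC _ _ _ _)).
- by apply: near_xs => //; lra.
- by apply: near_xs => //; lra.
- by rewrite -mulrA ler_wpM2l//; exact: xM.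
Qed.

End convex.

(** * The augmented Lagrangian *)

Section lagrangian.
Context {R : realType} {H G : hilbertType R}.
Context (f g : H -> R) (df : H -> H) (A : {linear H -> G}) (As : G -> H) (b : G) (rho : R).
Local Notation L := (augL f g A b rho).

(** The dual inequality at [l = ls + (A xs - b)] reads [|A xs - b|^2 <= 0]. *)
Lemma saddle_feasible xs ls : saddle_points f g A b rho (xs, ls) -> A xs = b.
Proof.
move=> /(_ xs (ls + (A xs - b))) /andP[/= + _].
rewrite /augL inner_addl inner_normE.
move=> h; apply/eqP; rewrite -subr_eq0 -normr_eq0 -sqrf_eq0.
by rewrite eq_le exprn_ge0// andbT; lra.
Qed.

Lemma convex_sqnorm_affine : convex_ineq (fun x => `|A x - b| ^+ 2).
Proof.
move=> k x y k0 k1.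
have -> : A (k *: x + (1 - k) *: y) - b = k *: (A x - b) + (1 - k) *: (A y - b).
  rewrite linearD !linearZ /= !scalerBr addrACA -opprD -scalerDl.
  by rewrite addrCA subrr addr0 scale1r.
move: (A x - b) (A y - b) => u v.
have : 0 <= k * (1 - k) * `|u - v| ^+ 2 by rewrite !mulr_ge0 ?exprn_ge0//; lra.
rewrite -!inner_normE !inner_addl !inner_addr !inner_oppl !inner_oppr.
rewrite !inner_scalel !inner_scaler (innerC v u).
nra.
Qed.

Lemma augL_convex_combination k x y l : convex_ineq f -> convex_ineq g -> A y = b ->
  0 <= k -> k <= 1 ->
  L (k *: x + (1 - k) *: y) l <=
    L y l + k * (f x + g x + inner l (A x - b) - f y - g y) + rho / 2 * (k ^+ 2 * `|A x - b| ^+ 2).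
Proof.
move=> cf cg Ay k0 k1.
have := cf k x y k0 k1; have := cg k x y k0 k1.
rewrite /augL linearD !linearZ /= Ay subrr inner_zeror normr0.
have -> : k *: A x + (1 - k) *: b - b = k *: (A x - b).
  by rewrite scalerBl scale1r scalerBr addrCA addrAC subrr add0r.
rewrite inner_scaler normrZ exprMn ger0_norm// expr0n/=; lra.
Qed.

(** The gap is [D + rho / 2 |A x - b|^2], where [D] is the gap of the Lagrangian
    without penalty.  Moving from [xs] towards [x] by a fraction [k] changes the
    Lagrangian by at most [k D + O(k^2)], because the penalty is quadratic and
    vanishes at [xs]; minimality of [xs] forces [D >= 0]. *)
Lemma saddle_gap_ge xs ls x : convex_ineq f -> convex_ineq g -> 0 <= rho ->
  saddle_points f g A b rho (xs, ls) ->
  rho / 2 * `|A x - b| ^+ 2 <= L x ls - L xs ls.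
Proof.
move=> cf cg rho0 S; have Axs := saddle_feasible S.
set D := f x + g x + inner ls (A x - b) - f xs - g xs.
set n := `|A x - b| ^+ 2.
have n0 : 0 <= n by rewrite exprn_ge0.
have -> : L x ls - L xs ls = D + rho / 2 * n.
  by rewrite /augL /D /n Axs subrr inner_zeror normr0 expr0n/=; ring.
rewrite lerDr; apply/ler_addgt0Pl => e e0.
pose c := rho / 2 * n.
have c0 : 0 <= c by rewrite !mulr_ge0//; lra.
(* this fraction makes the quadratic term at most e *)
pose k := e / (e + c).
have ec0 : 0 < e + c by lra.
have k0 : 0 < k by rewrite divr_gt0.
have k1 : k <= 1 by rewrite ler_pdivrMr// mul1r; lra.
have /andP[_ h] := S (k *: x + (1 - k) *: xs) ls.
have := le_trans h (augL_convex_combination x ls cf cg Axs (ltW k0) k1).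
rewrite /= -/D -/n => h'.
have : 0 <= k * (D + k * c) by rewrite /c; nra.
rewrite pmulr_rge0// => h2.
have : k * c <= e by rewrite /k mulrAC ler_pdivrMr//; nra.
lra.
Qed.

(** The inequalities for [f] and [g] are those of convexity, the coupling is
    affine, and the penalty is quadratic, which leaves the extra square. *)
Lemma augL_subgradient_ineq x y l v : convex_ineq f -> is_gradient f df ->
  is_adjoint A As -> subdifferential g x v ->
  L x l + inner (df x + v + As l + rho *: As (A x - b)) (y - x)
    + rho / 2 * `|A y - A x| ^+ 2 <= L y l.
Proof.
move=> cf gf adj sv.
have [dfx dE] := gf x.
have := convex_gradient_ineq y cf dfx; rewrite dE => hf.
have hg := sv y.
rewrite /augL.
have Ay : A y - b = (A x - b) + A (y - x).
  by rewrite linearB [RHS]addrC addrA subrK.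
rewrite -(linearB A) Ay !inner_addl inner_scalel !(innerC (As _)) -!adj {Ay}.
move: (y - x) (A x - b) (A (y - x)) hf hg => h p w hf hg.
rewrite inner_addr -!inner_normE !inner_addl !inner_addr !(innerC w).
lra.
Qed.

(** The part of the Lagrangian other than [g] is convex and continuous. *)
Lemma augL_locally_lipschitz l : convex_ineq f -> is_gradient f df ->
  convex_ineq g -> lower_semicontinuous (EFin \o g) -> continuous A -> 0 <= rho ->
  locally_lipschitz (fun x => L x l).
Proof.
move=> cf gf cg lg cA rho0.
pose q x := f x + inner l (A x - b) + rho / 2 * `|A x - b| ^+ 2.
have cq : convex_ineq q.
  move=> k x y k0 k1.
  have := cf k x y k0 k1; have := convex_sqnorm_affine x y k0 k1.
  rewrite /q; have -> : inner l (A (k *: x + (1 - k) *: y) - b)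
      = k * inner l (A x - b) + (1 - k) * inner l (A y - b).
    rewrite !inner_addr linearD !linearZ /= inner_addr !inner_scaler; ring.
  nra.
have ctq : continuous q.
  move=> x; have cAb : A z - b @[z --> x] --> A x - b.
    by apply: cvgB; [exact: cA | exact: cvg_cst].
  apply: cvgD; first apply: cvgD.
  - by apply: differentiable_continuous; have [] := gf x.
  - exact: cvg_inner.
  - apply: cvgMr; rewrite -[_ ^+ 2]/(_ * _).
    under eq_fun do rewrite expr2.
    by apply: cvgM; apply: cvg_norm.
have lq := continuous_convex_locally_lipschitz cq ctq.
have lgg := lsc_convex_locally_lipschitz cg lg.
move=> x; have [d d0 [C C0 qC]] := lq x; have [d' d'0 [C' C'0 gC]] := lgg x.
exists (Num.min d d'); first by rewrite lt_min d0.
exists (C + C'); first exact: addr_ge0.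
move=> y z; rewrite !lt_min => /andP[yd yd'] /andP[zd zd'].
have -> : L z l - L y l = (q z - q y) + (g z - g y) by rewrite /q /augL; ring.
rewrite mulrDl; apply: le_trans (ler_normD _ _) _.
by apply: lerD; [exact: qC|exact: gC].
Qed.

End lagrangian.

(** * The energy of a solution *)

Section anchored.
Context {R : realType}.

(** The vectors [V] and [W] in the energy have this form.  A factor [t - s] is
    extracted so that the other factor has a limit as [s] tends to [t]. *)
Lemma anchored_diff {V : normedModType R} (u u' : R -> V) (z : V) (c t s : R) : s != t ->
  (c *: (u t - z) + t *: u' t) - (c *: (u s - z) + s *: u' s) =
  (t - s) *: (c *: diff_quot u t s + (u' s + t *: diff_quot u' t s)).
Proof.
move=> st; rewrite [RHS]scalerDr scalerA [(t - s) * c]mulrC -scalerA -diff_quotE//.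
rewrite [(t - s) *: (_ + _)]scalerDr scalerA [(t - s) * t]mulrC -scalerA -diff_quotE//.
rewrite opprD addrACA -scalerBr.
have -> : u t - z - (u s - z) = u t - u s by rewrite opprB addrA subrK.
by congr (_ + _); rewrite scalerBl scalerBr [RHS]addrC addrA subrK.
Qed.

Lemma cvg_anchored {V : normedModType R} (I : set R) (u : R -> V) (c t : R) : I t ->
  derivable_on I u t -> {within I, continuous (derive_on I u)} ->
  derivable_on I (derive_on I u) t ->
  c *: diff_quot u t s + (derive_on I u s + t *: diff_quot (derive_on I u) t s)
    @[s --> within I t^'] -->
  c *: derive_on I u t + (derive_on I u t + t *: derive_on I (derive_on I u) t).
Proof.
move=> It du cu' du'; apply: cvgD; first by apply: cvgZr; exact: du.
apply: cvgD; first exact: within_continuous_cvg.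
by apply: cvgZr; exact: du'.
Qed.

End anchored.

Section energy.
Context {R : realType} {H G : hilbertType R}.
Context (f g : H -> R) (df : H -> H) (A : {linear H -> G}) (As : G -> H) (b : G) (rho : R).
Local Notation L := (augL f g A b rho).

(** The Lyapunov function of the system.  The velocities [x'] and [l'] are
    arguments because the derivatives intended here are relative to the
    half-line. *)
Definition energy (alpha : R) (beta : R -> R) (x x' : R -> H) (l l' : R -> G)
    (xs : H) (ls : G) (t : R) : R :=
  t ^+ 2 * beta t * (L (x t) ls - L xs ls)
  + `|(alpha - 1) *: (x t - xs) + t *: x' t| ^+ 2 / 2
  + `|(alpha - 1) *: (l t - ls) + t *: l' t| ^+ 2 / 2.

(** The algebra behind the decrease of the energy, at a fixed time: [x'], [x''],
    [beta'] and so on are plain variables.  With [u] and [w] the extrapolated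
    points relative to the saddle point, [V = (alpha - 1) u] and
    [W = (alpha - 1) w], so the two occurrences of [<A u, w>] cancel. *)
Lemma energy_derivative_le (alpha t beta beta' : R) (x x' x'' xs v : H) (l l' l'' ls : G) :
  convex_ineq f -> is_gradient f df -> is_adjoint A As -> A xs = b ->
  1 < alpha -> 0 < t -> 0 <= beta -> subdifferential g x v ->
  x'' + (alpha / t) *: x' + beta *: (df x + v + As (l + (t / (alpha - 1)) *: l')
     + rho *: As (A x - b)) = 0 ->
  l'' + (alpha / t) *: l' - beta *: (A (x + (t / (alpha - 1)) *: x') - b) = 0 ->
  (2 * t * beta + t ^+ 2 * beta') * (L x ls - L xs ls)
  + t ^+ 2 * beta * inner (df x + v + As ls + rho *: As (A x - b)) x'
  + inner ((alpha - 1) *: (x - xs) + t *: x') ((alpha - 1) *: x' + (x' + t *: x''))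
  + inner ((alpha - 1) *: (l - ls) + t *: l') ((alpha - 1) *: l' + (l' + t *: l''))
  <= - (((alpha - 3) * t * beta - t ^+ 2 * beta') * (L x ls - L xs ls)
        + (alpha - 1) * rho / 2 * (t * beta * `|A x - b| ^+ 2)).
Proof.
move=> cf gf adj Axs al1 t0 be0 sv odex odel.
have a10 : 0 < alpha - 1 by lra.
have := augL_subgradient_ineq b rho xs ls cf gf adj sv.
have -> : `|A xs - A x| = `|A x - b| by rewrite Axs distrC.
set z := df x + v + As ls + rho *: As (A x - b).
set n := `|A x - b| ^+ 2 => sub.
pose w := l - ls + (t / (alpha - 1)) *: l'.
pose u := x - xs + (t / (alpha - 1)) *: x'.
have scaled (V : hilbertType R) (p q r : V) c : t *: (r + (alpha / t) *: q + c *: p) =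
    (alpha - 1) *: q + (q + t *: r) + (t * c) *: p.
  have ta : t * (alpha / t) = alpha - 1 + 1 by field; rewrite gt_eqF.
  rewrite !scalerDr !scalerA ta scalerDl scale1r; congr (_ + _).
  by rewrite addrC addrA.
have tx : (alpha - 1) *: x' + (x' + t *: x'') =
    - (t * beta) *: (df x + v + As (l + (t / (alpha - 1)) *: l') + rho *: As (A x - b)).
  by apply/eqP; rewrite scaleNr -addr_eq0 -scaled odex scaler0.
have tl : (alpha - 1) *: l' + (l' + t *: l'') = (t * beta) *: A u.
  have -> : A u = A (x + (t / (alpha - 1)) *: x') - b by rewrite /u -Axs -linearB addrAC.
  by apply/eqP; rewrite -subr_eq0 -scaleNr -mulrN -scaled scaleNr odel scaler0.
have inzAs y : inner y (df x + v + As (l + (t / (alpha - 1)) *: l') + rho *: As (A x - b))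
    = inner z y + inner (A y) w.
  rewrite /z !inner_addl !inner_addr !inner_scaler !inner_scalel !(innerC _ y) -!adj.
  rewrite /w !inner_addr !inner_oppr !inner_scaler; ring.
have Vu : (alpha - 1) *: (x - xs) + t *: x' = (alpha - 1) *: u.
  by rewrite /u [RHS]scalerDr scalerA mulrCA divff ?mulr1// gt_eqF.
have Ww : (alpha - 1) *: (l - ls) + t *: l' = (alpha - 1) *: w.
  by rewrite /w [RHS]scalerDr scalerA mulrCA divff ?mulr1// gt_eqF.
have AuE : A ((alpha - 1) *: u) = (alpha - 1) *: A u by rewrite linearZ.
rewrite tx tl inner_scaler inzAs Vu Ww AuE !inner_scaler !inner_scalel (innerC w).
have -> : inner z u = inner z (x - xs) + t / (alpha - 1) * inner z x'.
  by rewrite /u inner_addr inner_scaler.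
have zx : inner z (xs - x) = - inner z (x - xs) by rewrite -inner_oppr opprB.
move: sub; rewrite zx => sub.
set P := L x ls - L xs ls.
have key : P + rho / 2 * n <= inner z (x - xs) by rewrite /P; lra.
have tb : 0 <= t * beta * (alpha - 1) by rewrite !mulr_ge0// ltW.
have := ler_wpM2l tb key.
set k := inner z (x - xs); set m := inner z x'; set i := inner (A u) w.
have -> : - (t * beta) * ((alpha - 1) * (k + t / (alpha - 1) * m) + (alpha - 1) * i)
   = - (t * beta * (alpha - 1) * k) - t ^+ 2 * beta * m - t * beta * (alpha - 1) * i.
  by field; rewrite gt_eqF.
lra.
Qed.

End energy.

Section energy_along_a_solution.
Context {R : realType} {H G : hilbertType R}.
Context (f g : H -> R) (df : H -> H) (A : {linear H -> G}) (As : G -> H) (b : G) (rho : R).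
Local Notation L := (augL f g A b rho).

(** The increment from [s < t] of each term of the energy is bounded linearly in
    the increments of the weight [t^2 beta], of [x], of [V] and of [W]: for the
    first term by the subgradient inequality at [x t], for the other two by
    [half_sqnormB].  The limit of the
    resulting bound is the expression of [energy_derivative_le]. *)
Lemma energy_left_slope (I : set R) (alpha : R) (beta : R -> R) (x : R -> H) (l : R -> G)
    (xs : H) (ls : G) (t : R)
    (x' := derive_on I x) (l' := derive_on I l) :
  convex_ineq f -> is_gradient f df -> is_adjoint A As -> A xs = b ->
  0 <= rho -> 1 < alpha -> I t -> 0 < t -> 0 <= beta t ->
  {within I, continuous beta} -> derivable_on I beta t ->
  {within I, continuous (fun s => L (x s) ls)} ->
  derivable_on I x t -> {within I, continuous x'} -> derivable_on I x' t ->
  derivable_on I l t -> {within I, continuous l'} -> derivable_on I l' t ->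
  [set derive_on I x' t + (alpha / t) *: x' t + beta t *: xi | xi in
     subdiff_x_augL g df A As b rho (x t) (l t + (t / (alpha - 1)) *: l' t)] 0 ->
  derive_on I l' t + (alpha / t) *: l' t
    - beta t *: grad_l_augL A b (x t + (t / (alpha - 1)) *: x' t) (l t) = 0 ->
  forall e, 0 < e -> exists2 c, c < t & forall s, I s -> c < s -> s < t ->
    energy f g A b rho alpha beta x x' l l' xs ls t
    - energy f g A b rho alpha beta x x' l l' xs ls s <=
    (e - (((alpha - 3) * t * beta t - t ^+ 2 * derive_on I beta t)
            * (L (x t) ls - L xs ls)
          + (alpha - 1) * rho / 2 * (t * beta t * `|A (x t) - b| ^+ 2))) * (t - s).
Proof.
move=> cf gf adj Axs rho0 al1 It t0 be0 cbe dbe cL dx cx' dx' dl cl' dl'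
  [_ [v sv <-]] odex odel.
set z := df (x t) + v + As ls + rho *: As (A (x t) - b).
pose Q s := ((s + t) * beta s + t ^+ 2 * diff_quot beta t s) * (L (x s) ls - L xs ls)
  + t ^+ 2 * beta t * inner z (diff_quot x t s)
  + inner ((alpha - 1) *: (x t - xs) + t *: x' t)
      ((alpha - 1) *: diff_quot x t s + (x' s + t *: diff_quot x' t s))
  + inner ((alpha - 1) *: (l t - ls) + t *: l' t)
      ((alpha - 1) *: diff_quot l t s + (l' s + t *: diff_quot l' t s)).
have cvQ : Q s @[s --> within I t^'] -->
  (2 * t * beta t + t ^+ 2 * derive_on I beta t) * (L (x t) ls - L xs ls)
  + t ^+ 2 * beta t * inner z (x' t)
  + inner ((alpha - 1) *: (x t - xs) + t *: x' t)
      ((alpha - 1) *: x' t + (x' t + t *: derive_on I x' t))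
  + inner ((alpha - 1) *: (l t - ls) + t *: l' t)
      ((alpha - 1) *: l' t + (l' t + t *: derive_on I l' t)).
  have -> : 2 * t * beta t = (t + t) * beta t by ring.
  apply: cvgD; last by apply: cvg_inner; exact: cvg_anchored.
  apply: cvgD; last by apply: cvg_inner; exact: cvg_anchored.
  apply: cvgD; last by apply: cvgMr; apply: cvg_inner; exact: dx.
  apply: cvgM; last first.
    apply: cvgB; last exact: cvg_cst.
    exact: (within_continuous_cvg cL It).
  apply: cvgD; last by apply: cvgMr; exact: dbe.
  apply: cvgM; last exact: within_continuous_cvg.
  apply: cvgD; last exact: cvg_cst.
  by apply: cvg_within_filter; apply: cvg_within_filter; exact: cvg_id.
apply: (left_slope_le (Q := Q) _ cvQ); last first.
  exact: (energy_derivative_le (derive_on I beta t) ls cf gf adj Axs al1 t0 be0 sv odex odel).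
move=> s Is st.
have nst : s != t by rewrite lt_eqF.
have ts0 : 0 < t - s by rewrite subr_gt0.
rewrite /energy.
have hV := half_sqnormB ((alpha - 1) *: (x t - xs) + t *: x' t) ((alpha - 1) *: (x s - xs) + s *: x' s).
have hW := half_sqnormB ((alpha - 1) *: (l t - ls) + t *: l' t) ((alpha - 1) *: (l s - ls) + s *: l' s).
rewrite anchored_diff// inner_scaler in hV.
rewrite anchored_diff// inner_scaler in hW.
have := augL_subgradient_ineq b rho (x s) ls cf gf adj sv.
rewrite -/z -opprB inner_oppr diff_quotE// inner_scaler => hz.
have hn : 0 <= rho / 2 * `|A (x s) - A (x t)| ^+ 2.
  by rewrite mulr_ge0 ?exprn_ge0//; lra.
have hb : beta t - beta s = (t - s) * diff_quot beta t s := diff_quotE beta nst.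
have hL : L (x t) ls - L (x s) ls <= (t - s) * inner z (diff_quot x t s) by lra.
have k0 : 0 <= t ^+ 2 * beta t by rewrite mulr_ge0// exprn_ge0// ltW.
have := ler_wpM2l k0 hL.
rewrite /Q; move: hV hW hb.
set hVs := inner _ (_ *: _ + _); set hWs := inner _ (_ *: _ + _).
set nV := _ ^+ 2 / 2; set nV' := _ ^+ 2 / 2; set nW := _ ^+ 2 / 2; set nW' := _ ^+ 2 / 2.
move: hVs hWs nV nV' nW nW' (inner z _) (diff_quot beta t s) => vs ws nV nV' nW nW' iz d hV hW hb hLk.
have -> : t ^+ 2 * beta t * (L (x t) ls - L xs ls) + nV + nW
    - (s ^+ 2 * beta s * (L (x s) ls - L xs ls) + nV' + nW') =
  (t ^+ 2 * (beta t - beta s) + (t ^+ 2 - s ^+ 2) * beta s) * (L (x s) ls - L xs ls)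
  + t ^+ 2 * beta t * (L (x t) ls - L (x s) ls) + (nV - nV') + (nW - nW') by ring.
rewrite hb; lra.
Qed.

Lemma energy_abs_continuous (alpha t0 c : R) (beta : R -> R) (x : R -> H) (l : R -> G)
    (x' : R -> H) (l' : R -> G) xs ls (I := `[t0, +oo[%classic) :
  t0 <= c -> C1_on I beta -> C1_on I x -> C1_on I l ->
  abs_continuous t0 c x' -> abs_continuous t0 c l' ->
  locally_lipschitz (fun y => L y ls) ->
  abs_continuous t0 c (energy f g A b rho alpha beta x x' l l' xs ls).
Proof.
move=> tc Cbeta Cx Cl acx' acl' lipL.
have sub t : t0 <= t -> t <= c -> I t by rewrite /I/= in_itv/= andbT.
have acid := abs_continuous_id t0 c.
have accst (V : normedModType R) (z : V) := abs_continuous_cst t0 c z.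
have acx := C1_on_abs_continuous sub Cx.
have acl := C1_on_abs_continuous sub Cl.
have anch (V : normedModType R) (u u' : R -> V) z : abs_continuous t0 c u ->
    abs_continuous t0 c u' ->
    abs_continuous t0 c (fun t => `|(alpha - 1) *: (u t - z) + t *: u' t| ^+ 2 / 2).
  move=> acu acu'; apply: abs_continuous_half_sqnorm; apply: abs_continuousD.
    apply: (abs_continuousZ (k := fun=> alpha - 1)) => //.
    exact: (abs_continuousD acu (accst _ (- z))).
  exact: abs_continuousZ.
apply: abs_continuousD; last exact: anch.
apply: abs_continuousD; last exact: anch.
have acbeta := C1_on_abs_continuous sub Cbeta.
have [M M0 xM] := C1_on_lipschitz sub Cx.
apply: (abs_continuousZ (u := fun t => L (x t) ls - L xs ls)).
  apply: (abs_continuousZ (u := beta)) => //.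
  exact: (abs_continuousZ acid acid).
apply: (abs_continuousD (v := fun=> - L xs ls)) => //.
exact: (abs_continuous_locally_lipschitz_comp tc lipL M0 xM).
Qed.

End energy_along_a_solution.

(** * Convergence rates *)

Lemma eqO_pinfty_bound {R : realType} {V : normedModType R} (u : R -> V) (v : R -> R) (t0 C : R) :
  (forall t, t0 <= t -> `|u t| <= C * `|v t|) -> u =O_ (pinfty_nbhs R) v.
Proof.
move=> uv; apply/eqO_exP; exists (`|C| + 1); first by rewrite ltr_wpDl.
exists t0; split; first exact: num_real.
move=> t /ltW /uv h; apply: le_trans h _.
by rewrite ler_wpM2r// (le_trans (ler_norm C))// lerDl.
Qed.

Theorem theorem3p1 (R : realType) (H G : hilbertType R)
    (f g : H -> R) (df : H -> H)
    (A : {linear H -> G}) (As : G -> H) (b : G)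
    (f_convex : convex_function [set: convex_lmodType H] f)
    (f_gradient : is_gradient f df)
    (df_lipschitz : lipschitz df)
    (g_proper : proper_function (EFin \o g))
    (g_convex : convex_function [set: convex_lmodType H] g)
    (g_lsc : lower_semicontinuous (EFin \o g))
    (A_continuous : continuous A)
    (As_adjoint : is_adjoint A As)
    (alpha rho t0 : R) (beta : R -> R)
    (alpha_ge3 : 3 <= alpha) (rho_gt0 : 0 < rho) (t0_gt0 : 0 < t0)
    (S_neq0 : saddle_points f g A b rho !=set0)
    (beta_gt0 : forall t, t0 <= t -> 0 < beta t)
    (beta_ndecr : {in `[t0, +oo[ &, {homo beta : s t / s <= t}})
    (beta_C1 : C1_on `[t0, +oo[ beta)
    (beta_growth :
      (ereal_sup [set (t * derive_on `[t0, +oo[ beta t / beta t)%:E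
                 | t in `[t0, +oo[] <= (alpha - 3)%:E)%E)
    (x : R -> H) (l : R -> G)
    (xl_sol : is_solution g df A As b rho alpha t0 beta x l) :
  forall (xs : H) (ls : G), saddle_points f g A b rho (xs, ls) ->
    let L := augL f g A b rho in
    [/\ (fun t => L (x t) ls - L xs ls)
          =O_ (pinfty_nbhs R) (fun t => (t ^+ 2 * beta t)^-1),
        (fun t => `|A (x t) - b|)
          =O_ (pinfty_nbhs R) (fun t => (t * Num.sqrt (beta t))^-1),
        (fun t => `|(f \+ g) (x t) - (f \+ g) xs|)
          =O_ (pinfty_nbhs R) (fun t => (t * Num.sqrt (beta t))^-1),
        (\int[@lebesgue_measure R]_(t in `[t0, +oo[)
           (t * beta t * `|A (x t) - b| ^+ 2)%:E < +oo)%E &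
        (\int[@lebesgue_measure R]_(t in `[t0, +oo[)
           (((alpha - 3) * t * beta t
              - t ^+ 2 * derive_on `[t0, +oo[ beta t)
            * (L (x t) ls - L xs ls))%:E < +oo)%E].
Proof.
move=> xs ls S L.
have cf := convex_function_ineq f_convex; have cg := convex_function_ineq g_convex.
have Axs := saddle_feasible S.
have rho0 := ltW rho_gt0.
have al1 : 1 < alpha by lra.
case: xl_sol; set I := `[t0, +oo[%classic => Cx Cl acx' acl' ode.
have IP t : I t <-> t0 <= t by rewrite /I/= in_itv/= andbT.
have gap t : rho / 2 * `|A (x t) - b| ^+ 2 <= L (x t) ls - L xs ls.
  exact: saddle_gap_ge cf cg rho0 S.
have gap0 t : 0 <= L (x t) ls - L xs ls.
  by apply: le_trans (gap t); rewrite mulr_ge0 ?exprn_ge0//; lra.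
have lipL : locally_lipschitz (fun y => L y ls).
  exact: augL_locally_lipschitz cf f_gradient cg g_lsc A_continuous rho0.
have cbeta : {within I, continuous beta} := derivable_on_continuous beta_C1.1.
have cx : {within I, continuous x} := derivable_on_continuous Cx.1.
have cLx : {within I, continuous (fun t => L (x t) ls)}.
  exact: (within_continuous_comp cx (locally_lipschitz_continuous lipL)).
have cAx : {within I, continuous (fun t => A (x t) - b)}.
  move=> t; apply: cvgB; last exact: cvg_cst.
  exact: (within_continuous_comp cx A_continuous).
have cid : {within I, continuous (fun t : R => t)}.
  by apply: continuous_subspaceT => t; exact: cvg_id.
have ch1 : {within I, continuous (fun t => t * beta t * `|A (x t) - b| ^+ 2)}.
  move=> t; apply: cvgM; first by apply: cvgM; [exact: cid | exact: cbeta].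
  under eq_fun do rewrite expr2.
  by rewrite expr2; apply: cvgM; apply: cvg_norm; exact: cAx.
have ch2 : {within I, continuous (fun t =>
    ((alpha - 3) * t * beta t - t ^+ 2 * derive_on I beta t) * (L (x t) ls - L xs ls))}.
  move=> t; apply: cvgM; last by apply: cvgB; [exact: cLx | exact: cvg_cst].
  apply: cvgB.
    by apply: cvgM; [apply: cvgMr; exact: cid | exact: cbeta].
  apply: cvgM; last exact: beta_C1.2.
  under eq_fun do rewrite expr2.
  by rewrite expr2; apply: cvgM; exact: cid.
have h1_ge0 t : t0 <= t -> 0 <= t * beta t * `|A (x t) - b| ^+ 2.
  by move=> tt; rewrite !mulr_ge0 ?exprn_ge0// ?ltW ?beta_gt0//; lra.
have h2_ge0 t : t0 <= t -> 0 <= ((alpha - 3) * t * beta t - t ^+ 2 * derive_on I beta t)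
    * (L (x t) ls - L xs ls).
  move=> tt; rewrite mulr_ge0// subr_ge0.
  have : ((t * derive_on I beta t / beta t)%:E <= (alpha - 3)%:E)%E.
    apply: le_trans beta_growth; apply: ereal_sup_ubound.
    by exists t => //; apply/IP.
  rewrite lee_fin ler_pdivrMr ?beta_gt0// => h.
  have t_ge0 : 0 <= t by lra.
  have := ler_wpM2l t_ge0 h; rewrite expr2; lra.
pose E := energy f g A b rho alpha beta x (derive_on I x) l (derive_on I l) xs ls.
have E0 t : t0 <= t -> 0 <= E t.
  move=> tt; have bt := ltW (beta_gt0 t tt).
  have half (y : R) : 0 <= y ^+ 2 / 2 by rewrite divr_ge0 ?sqr_ge0.
  apply: addr_ge0; last exact: half.
  apply: addr_ge0; last exact: half.
  by apply: mulr_ge0; [apply: mulr_ge0; [exact: sqr_ge0|] | exact: gap0].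
have acE c : t0 <= c -> abs_continuous t0 c E.
  move=> tc; apply: energy_abs_continuous => //.
    exact: acx'.
  exact: acl'.
have aeF : Filter (almost_everywhere (@lebesgue_measure R : measure _ _)).
  exact: ae_filter_ringOfSetsType.
have slope : {ae @lebesgue_measure R, forall t, I t -> forall e, 0 < e ->
    exists2 c, c < t & forall s, t0 <= s -> c < s -> s < t ->
      E t - E s <= (e -
        (((alpha - 3) * t * beta t - t ^+ 2 * derive_on I beta t) * (L (x t) ls - L xs ls)
         + (alpha - 1) * rho / 2 * (t * beta t * `|A (x t) - b| ^+ 2))) * (t - s)}.
  apply: (@filterS _ _ aeF) ode => t odet It e e0.
  have [dx' dl' odex odel] := odet It.
  have tt := (IP t).1 It.
  have [c ct cP] : exists2 c, c < t & forall s, I s -> c < s -> s < t ->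
      E t - E s <= (e -
        (((alpha - 3) * t * beta t - t ^+ 2 * derive_on I beta t) * (L (x t) ls - L xs ls)
         + (alpha - 1) * rho / 2 * (t * beta t * `|A (x t) - b| ^+ 2))) * (t - s).
    apply: (energy_left_slope cf f_gradient As_adjoint Axs rho0 al1 It) => //.
    - by lra.
    - exact/ltW/beta_gt0.
    - exact: beta_C1.1.
    - exact: Cx.1.
    - exact: Cx.2.
    - exact: Cl.1.
    - exact: Cl.2.
  by exists c => // s s0; apply: cP; exact/IP.
have c1_gt0 : 0 < (alpha - 1) * rho / 2 by rewrite !mulr_gt0 ?invr_gt0//; lra.
have weaken h : (forall t, t0 <= t -> h t <=
    ((alpha - 3) * t * beta t - t ^+ 2 * derive_on I beta t) * (L (x t) ls - L xs ls)
    + (alpha - 1) * rho / 2 * (t * beta t * `|A (x t) - b| ^+ 2)) ->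
  {ae @lebesgue_measure R, forall t, I t -> forall e, 0 < e ->
    exists2 c, c < t & forall s, t0 <= s -> c < s -> s < t ->
      E t - E s <= (e - h t) * (t - s)}.
  move=> hle; apply: (@filterS _ _ aeF) slope => t st It e e0.
  have [c ct cP] := st It e e0; exists c => // s s0 cs st'.
  apply: le_trans (cP s s0 cs st') _.
  rewrite ler_wpM2r ?subr_ge0 ?(ltW st')// lerD2l lerN2.
  exact/hle/IP.
have [Edecr int2] : (forall t, t0 <= t -> E t <= E t0) /\
    (\int[@lebesgue_measure R]_(t in I)
       (((alpha - 3) * t * beta t - t ^+ 2 * derive_on I beta t) * (L (x t) ls - L xs ls))%:E
     < +oo)%E.
  apply: (dissipation_integral acE ch2 E0 h2_ge0); apply: weaken => t tt.
  by rewrite lerDl mulr_ge0 ?(ltW c1_gt0) ?h1_ge0.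
have int1 : (\int[@lebesgue_measure R]_(t in I) (t * beta t * `|A (x t) - b| ^+ 2)%:E < +oo)%E.
  (* the energy is rescaled because its slope involves a multiple of the
     integrand *)
  have c1E0 t : t0 <= t -> 0 <= ((alpha - 1) * rho / 2)^-1 * E t.
    by move=> tt; rewrite mulr_ge0 ?invr_ge0 ?(ltW c1_gt0) ?E0.
  have c1acE c : t0 <= c -> abs_continuous t0 c (fun t => ((alpha - 1) * rho / 2)^-1 * E t).
    by move=> tc; apply: (abs_continuousZ (u := E)) (acE c tc); exact: abs_continuous_cst.
  apply: (proj2 (dissipation_integral c1acE ch1 c1E0 h1_ge0 _)).
  apply: (@filterS _ _ aeF) slope => t st It e e0.
  have [|c ct cP] := st It ((alpha - 1) * rho / 2 * e); first exact: mulr_gt0.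
  exists c => // s s0 cs st'.
  have := cP s s0 cs st'; rewrite -mulrBr ler_pdivrMl// => /le_trans; apply.
  rewrite [leRHS]mulrA ler_wpM2r ?subr_ge0 ?(ltW st')// [leRHS]mulrBr lerD2l lerN2 lerDr.
  exact/h2_ge0/IP.
pose p t := t * Num.sqrt (beta t).
have pE t : t0 <= t -> t ^+ 2 * beta t = p t ^+ 2.
  by move=> tt; rewrite exprMn sqr_sqrtr// ltW// beta_gt0.
have p_gt0 t : t0 <= t -> 0 < p t.
  by move=> tt; rewrite mulr_gt0 ?sqrtr_gt0 ?beta_gt0//; lra.
have gapE t : t0 <= t -> p t ^+ 2 * (L (x t) ls - L xs ls) <= E t0.
  move=> tt; apply: le_trans (Edecr t tt); rewrite -pE//.
  apply: (@le_trans _ _ (t ^+ 2 * beta t * (L (x t) ls - L xs ls)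
      + `|(alpha - 1) *: (x t - xs) + t *: derive_on I x t| ^+ 2 / 2)).
    by rewrite lerDl divr_ge0 ?sqr_ge0.
  by rewrite [leRHS]/E /energy lerDl divr_ge0 ?sqr_ge0.
have Et0 := E0 t0 (lexx _).
pose K := 2 * E t0 / rho + 1.
have K0 : 0 < K by rewrite ltr_wpDl// !mulr_ge0// invr_ge0.
have feas t : t0 <= t -> `|A (x t) - b| <= K / p t.
  move=> tt; rewrite ler_pdivlMr ?p_gt0//.
  set y := `|A (x t) - b| * p t.
  have y2 : rho / 2 * y ^+ 2 <= E t0.
    by apply: le_trans (gapE t tt); rewrite /y [(_ * p t) ^+ 2]exprMn mulrA mulrC ler_wpM2l ?sqr_ge0//.
  have : y ^+ 2 <= 2 * E t0 / rho by rewrite ler_pdivlMr//; lra.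
  rewrite /K; nra.
split => //.
- apply: (@eqO_pinfty_bound _ _ _ _ t0 (E t0)) => t tt.
  rewrite ger0_norm// pE// ger0_norm ?invr_ge0 ?sqr_ge0//.
  by rewrite ler_pdivlMr ?exprn_gt0 ?p_gt0// mulrC gapE.
- apply: (@eqO_pinfty_bound _ _ _ _ t0 K) => t tt.
  rewrite normr_id ger0_norm ?invr_ge0 ?(ltW (p_gt0 t tt))//.
  exact: feas.
- apply: (@eqO_pinfty_bound _ _ _ _ t0 (E t0 / p t0 + `|ls| * K)) => t tt.
  rewrite normr_id [X in _ <= _ * X]ger0_norm ?invr_ge0 ?(ltW (p_gt0 t tt))//.
  have pt := p_gt0 t tt; have pt0 := p_gt0 t0 (lexx _).
  have -> : (f \+ g) (x t) - (f \+ g) xs = (L (x t) ls - L xs ls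
      - rho / 2 * `|A (x t) - b| ^+ 2) - inner ls (A (x t) - b).
    by rewrite /L /augL /= Axs subrr inner_zeror normr0 expr0n/=; ring.
  apply: le_trans (ler_normB _ _) _; rewrite mulrDl; apply: lerD; last first.
    apply: le_trans (normr_inner_le _ _) _.
    by rewrite -mulrA ler_wpM2l// feas.
  have n0 : 0 <= rho / 2 * `|A (x t) - b| ^+ 2 by rewrite mulr_ge0 ?sqr_ge0//; lra.
  rewrite ger0_norm; last by have := gap t; lra.
  apply: (@le_trans _ _ (L (x t) ls - L xs ls)); first by lra.
  apply: (@le_trans _ _ (E t0 / p t ^+ 2)).
    by rewrite ler_pdivlMr ?exprn_gt0// mulrC gapE.
  rewrite expr2 invfM mulrA ler_wpM2r ?invr_ge0 ?(ltW pt)//.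
  rewrite ler_wpM2l// lef_pV2 ?posrE//.
  apply: ler_pM => //; [lra|].
  by rewrite ler_wsqrtr// beta_ndecr// ?inE; apply/IP.
Qed.
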